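(* Let $(M_n)$ be a non-quasi-analytic weight sequence and let $\phi$ be a map from $[0,1]$ to $[0,1]$. Suppose that $\phi$ induces a compact endomorphism of $D([0,1],M)$. Then $|\phi'(x)|<1$ for all $x\in(0,1)$. Thus, if $\phi$ induces a compact endomorphism of $D([0,1],M)$ and $|\phi'|$ attains its maximum over $[0,1]$ at some point of $(0,1)$, then $\|\phi'\|_\infty<1$.
   Context: A weight sequence is a sequence $(M_n)_{n\ge 0}$ of positive real numbers with $M_0=1$ and $\frac{M_{n+m}}{M_nM_m}\ge\binom{n+m}{m}$ for all non-negative integers $m,n$. It is non-quasi-analytic if $\sum_{n}\frac{M_n}{M_{n+1}}<\infty$ (this implies $\lim_{n\to\infty}(n!/M_n)^{1/n}=0$). $D([0,1],M)$ is the set of complex-valued infinitely differentiable functions $f$ on $[0,1]$ (one-sided derivatives at endpoints) with $\|f\|_D=\sum_{n=0}^\infty \frac{\|f^{(n)}\|_\infty}{M_n}<\infty$, where $\|\cdot\|_\infty$ is the supremum norm on $[0,1]$; with pointwise operations and the norm $\|\cdot\|_D$ it is a unital commutative semisimple Banach algebra. A map $\phi:[0,1]\to[0,1]$ induces an endomorphism of $D([0,1],M)$ if $f\circ\phi\in D([0,1],M)$ for every $f\in D([0,1],M)$; the endomorphism is then $T:f\mapsto f\circ\phi$ (automatically continuous), and $\phi$ induces a compact endomorphism if moreover $T$ is a compact operator. Since $f(x)=x$ lies in $D([0,1],M)$, such a $\phi$ automatically lies in $D([0,1],M)$, so $\phi'$ makes sense. *)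

(* Defs.v *)
From Stdlib Require Import Reals.
From Coquelicot Require Import Coquelicot.
Open Scope R_scope.

(* A function on [0,1] is represented by a total function on R of which only
   the values on [0,1] matter: every notion below (derivatives at points of
   [0,1], sup norm, membership in D, its norm, convergence) depends only on
   the restriction to [0,1]. *)

Definition I01 (x : R) : Prop := 0 <= x <= 1.

(* Limit of the difference quotient over y in [0,1], y <> x: two-sided at
   interior points, one-sided at 0 and 1. *)
Definition is_derive01 (f : R -> C) (x : R) (l : C) : Prop :=
  filterlim (fun y : R => ((f y - f x) / RtoC (y - x))%C)
            (within I01 (locally' x)) (locally l).

Definition ex_derive01 (f : R -> C) (x : R) : Prop :=
  exists l : C, is_derive01 f x l.

(* Coquelicot's definite description; it is the derivative wherever
   [ex_derive01 f x] holds and x is in [0,1]. *)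
Definition Derive01 (f : R -> C) (x : R) : C :=
  iota (T := C_CompleteNormedModule) (is_derive01 f x).

Fixpoint Derive01_n (f : R -> C) (n : nat) : R -> C :=
  match n with
  | O => f
  | S k => Derive01 (Derive01_n f k)
  end.

Definition smooth01 (f : R -> C) : Prop :=
  forall (n : nat) (x : R), I01 x -> ex_derive01 (Derive01_n f n) x.

(* [real] sends an infinite supremum to 0; this is only used below for
   functions continuous on [0,1], whose supremum is finite. *)
Definition supnorm01 (f : R -> C) : R :=
  real (Lub_Rbar (fun r : R => exists x : R, I01 x /\ r = Cmod (f x))).

Definition weight_sequence (M : nat -> R) : Prop :=
  (forall n : nat, 0 < M n) /\
  M 0%nat = 1 /\
  (forall m n : nat, M (n + m)%nat / (M n * M m) >= Binomial.C (n + m) m).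

Definition non_quasi_analytic (M : nat -> R) : Prop :=
  ex_series (fun n : nat => M n / M (S n)).

Definition D_terms (M : nat -> R) (f : R -> C) (n : nat) : R :=
  supnorm01 (Derive01_n f n) / M n.

Definition in_D (M : nat -> R) (f : R -> C) : Prop :=
  smooth01 f /\ ex_series (D_terms M f).

Definition norm_D (M : nat -> R) (f : R -> C) : R := Series (D_terms M f).

Definition converges_D (M : nat -> R) (f : nat -> R -> C) (g : R -> C) : Prop :=
  is_lim_seq (fun n : nat => norm_D M (fun x : R => (f n x - g x)%C)) 0.

Definition comp_op (phi : R -> R) (f : R -> C) : R -> C := fun x : R => f (phi x).

Definition induces_endomorphism (M : nat -> R) (phi : R -> R) : Prop :=
  forall f : R -> C, in_D M f -> in_D M (comp_op phi f).

(* Every bounded sequence in D has a subsequence whose image under T converges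
   in the norm of D. *)
Definition compact_operator_D (M : nat -> R) (T : (R -> C) -> R -> C) : Prop :=
  forall f : nat -> R -> C,
    (forall n : nat, in_D M (f n)) ->
    (exists B : R, forall n : nat, norm_D M (f n) <= B) ->
    exists (k : nat -> nat) (g : R -> C),
      (forall n : nat, (k n < k (S n))%nat) /\
      in_D M g /\
      converges_D M (fun n : nat => T (f (k n))) g.

Definition induces_compact_endomorphism (M : nat -> R) (phi : R -> R) : Prop :=
  induces_endomorphism M phi /\ compact_operator_D M (comp_op phi).

(* phi seen as a complex-valued function, so that the derivative and sup norm
   above apply to it. *)
Definition as_C (phi : R -> R) : R -> C := fun x : R => RtoC (phi x).

(* Main.v *)
(* Suppose |phi'(x0)| >= 1 at an interior point x0. Then y0 = phi(x0) is interior,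
   since phi' vanishes at interior extrema. If x0 were a fixed point, the compact
   operator T would preserve the closed subspaces V_n of functions vanishing to
   order n at x0 and act as phi'(x0)^n on the lines V_n / V_{n+1}, which Riesz's
   lemma forbids. The general case reduces to this one: non-quasi-analyticity
   provides a bump in D (an infinite convolution of box functions, as in
   Denjoy-Carleman), and multiplying by it before translating from x0 to y0 gives
   a bounded operator S such that T S acts on jets at x0 as if x0 were fixed. *)

Require Import Defs.
From Stdlib Require Import Factorial Reals Lra Lia ClassicalEpsilon.
From Coquelicot Require Import Coquelicot.
Open Scope R_scope.

(** * Derivatives on [0,1] *)

(** Compactness is contradicted by one sequence. For each n take h_n vanishing to order n at x0, of
    norm at most 2, such that |f^(n)(x0)| <= ||f|| |h_n^(n)(x0)| for every f vanishing to order n at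
    x0. If i < j, then T S h_i - T S h_j vanishes to order i at x0, and its i-th derivative there is
    h_i^(i)(x0) phi'(x0)^i, because T S h_j contributes nothing at order i. Hence its norm is at
    least |phi'(x0)|^i >= 1, and no subsequence of the images converges. The obstacle to moving x0
    to y0 is that a translation does not preserve [0,1], so h must first be cut off inside D.
    Averaging over an interval of half-width a makes a function differentiable at the cost of a
    factor 1/a. With half-widths M_n / M_(n+1) these costs multiply to M_n / M_0, exactly the growth
    that D measures, while the support grows by the sum of the half-widths, finite by
    non-quasi-analyticity. The binomial inequality on M then bounds multiplication by the
    cut-off. *)

Lemma is_derive01_iff (f : R -> C) (x : R) (l : C) :
  is_derive01 f x l <->
  forall eps : R, 0 < eps -> exists delta : R, 0 < delta /\
    forall y : R, I01 y -> Rabs (y - x) < delta ->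
      Cmod (f y - f x - l * (y - x)%R)%C <= eps * Rabs (y - x).
Proof.
  assert (Q : forall y : R, y <> x ->
    Cmod (f y - f x - l * (y - x)%R)%C
    = Cmod ((f y - f x) / RtoC (y - x) - l)%C * Rabs (y - x)).
  { intros y Hy. rewrite <- Cmod_R, <- Cmod_mult. f_equal.
    assert (H : RtoC (y - x) <> 0%C).
    { intros H. apply Hy. apply RtoC_inj in H. lra. }
    field. exact H. }
  unfold is_derive01. split.
  - intros H eps Heps.
    destruct (proj1 (@filterlim_locally_ball_norm C_AbsRing R C_NormedModule
      _ _ _ l) H (mkposreal eps Heps)) as [d Hd].
    exists d. split; [apply cond_pos|]. intros y Iy Hy.
    destruct (Req_dec y x) as [->|Hne].
    + rewrite Rminus_diag. replace (f x - f x - l * 0%R)%C with (RtoC 0) by ring.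
      rewrite Cmod_0, Rabs_R0. lra.
    + rewrite Q by exact Hne. apply Rmult_le_compat_r; [apply Rabs_pos|].
      specialize (Hd y Hy Hne Iy).       apply Rlt_le, Hd.
  - intros H. refine (proj2 (@filterlim_locally_ball_norm C_AbsRing R C_NormedModule
      _ _ _ l) _).
    intros eps. destruct (H (eps / 2)) as [d [Hd0 Hd]].
    { destruct eps; simpl; lra. }
    exists (mkposreal d Hd0). intros y Hy Hne Iy. unfold ball_norm.
    specialize (Hd y Iy Hy). rewrite Q in Hd by exact Hne.
    apply Rmult_le_reg_r in Hd; [|apply Rabs_pos_lt; lra].
    apply Rle_lt_trans with (1 := Hd). destruct eps; simpl; lra.
Qed.

(** No point of [0,1] is isolated in it: step to the right from the left half and to the left from
    the right half. Limits along this filter are therefore unique, which [iota] relies on. *)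
Lemma proper_within01 (x : R) : I01 x -> ProperFilter' (within I01 (locally' x)).
Proof.
  intros Ix. constructor.
  - intros [d Hd]. destruct d as [d Hd0]. unfold I01 in Ix.
    pose proof (Rmin_l (d/2) (1/2)). pose proof (Rmin_r (d/2) (1/2)).
    pose proof (Rmin_pos (d/2) (1/2) ltac:(lra) ltac:(lra)).
    destruct (Rle_dec x (1/2)).
    + apply (Hd (x + Rmin (d/2) (1/2))); [|lra|split; lra].
      change (Rabs (x + Rmin (d/2) (1/2) - x) < d). apply Rabs_def1; lra.
    + apply (Hd (x - Rmin (d/2) (1/2))); [|lra|split; lra].
      change (Rabs (x - Rmin (d/2) (1/2) - x) < d). apply Rabs_def1; lra.
  - apply within_filter. apply within_filter. apply locally_filter.
Qed.

Lemma is_derive01_unique (f : R -> C) (x : R) (l : C) :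
  I01 x -> is_derive01 f x l -> Derive01 f x = l.
Proof.
  intros Ix H. unfold Derive01, is_derive01.
  apply (@iota_filterlim_locally C_AbsRing C_CompleteNormedModule R
    (within I01 (locally' x)) (proper_within01 x Ix)
    (fun y : R => ((f y - f x) / RtoC (y - x))%C) l). exact H.
Qed.

Lemma is_derive01_ext (f g : R -> C) (x : R) (l : C) :
  I01 x -> (forall y, I01 y -> f y = g y) ->
  is_derive01 f x l -> is_derive01 g x l.
Proof.
  rewrite !is_derive01_iff. intros Ix E H eps Heps.
  destruct (H eps Heps) as [d [Hd0 Hd]]. exists d. split; [exact Hd0|].
  intros y Iy Hy. rewrite <- (E y Iy), <- (E x Ix). apply Hd; assumption.
Qed.

Lemma is_derive01_local (f g : R -> C) (x : R) (l : C) (r : R) :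
  I01 x -> 0 < r ->
  (forall y, I01 y -> Rabs (y - x) < r -> f y = g y) ->
  is_derive01 f x l -> is_derive01 g x l.
Proof.
  rewrite !is_derive01_iff. intros Ix Hr E H eps Heps.
  destruct (H eps Heps) as [d [Hd0 Hd]]. exists (Rmin d r).
  split; [apply Rmin_pos; assumption|].
  intros y Iy Hy.
  rewrite <- (E y Iy), <- (E x Ix).
  - apply Hd; [exact Iy|]. eapply Rlt_le_trans; [exact Hy|apply Rmin_l].
  - rewrite Rminus_diag, Rabs_R0. exact Hr.
  - eapply Rlt_le_trans; [exact Hy|apply Rmin_r].
Qed.

Lemma is_derive01_const (c : C) (x : R) : is_derive01 (fun _ => c) x 0%C.
Proof.
  apply is_derive01_iff. intros eps Heps. exists 1. split; [lra|].
  intros y _ _. replace (c - c - 0 * (y - x)%R)%C with (RtoC 0) by ring.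
  rewrite Cmod_0. pose proof (Rabs_pos (y - x)). nra.
Qed.

Lemma is_derive01_plus (f g : R -> C) (x : R) (l m : C) :
  is_derive01 f x l -> is_derive01 g x m ->
  is_derive01 (fun y => f y + g y)%C x (l + m)%C.
Proof.
  rewrite !is_derive01_iff. intros Hf Hg eps Heps.
  destruct (Hf (eps/2)) as [d [Hd0 Hd]]; [lra|].
  destruct (Hg (eps/2)) as [e [He0 He]]; [lra|].
  exists (Rmin d e). split; [apply Rmin_pos; assumption|].
  intros y Iy Hy.
  assert (H1 := Hd y Iy (Rlt_le_trans _ _ _ Hy (Rmin_l _ _))).
  assert (H2 := He y Iy (Rlt_le_trans _ _ _ Hy (Rmin_r _ _))).
  replace (f y + g y - (f x + g x) - (l + m) * (y - x)%R)%C with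
    ((f y - f x - l * (y - x)%R) + (g y - g x - m * (y - x)%R))%C by ring.
  eapply Rle_trans; [apply Cmod_triangle|]. lra.
Qed.

Lemma is_derive01_lipschitz_at (f : R -> C) (x : R) (l : C) :
  is_derive01 f x l ->
  exists delta, 0 < delta /\ forall y, I01 y -> Rabs (y - x) < delta ->
    Cmod (f y - f x)%C <= (Cmod l + 1) * Rabs (y - x).
Proof.
  rewrite is_derive01_iff. intros H. destruct (H 1 Rlt_0_1) as [d [Hd0 Hd]].
  exists d. split; [exact Hd0|]. intros y Iy Hy.
  replace (f y - f x)%C with ((f y - f x - l * (y - x)%R) + l * (y - x)%R)%C by ring.
  eapply Rle_trans; [apply Cmod_triangle|].
  rewrite Cmod_mult, Cmod_R. specialize (Hd y Iy Hy). lra.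
Qed.

Lemma is_derive01_mult (f g : R -> C) (x : R) (l m : C) :
  is_derive01 f x l -> is_derive01 g x m ->
  is_derive01 (fun y => f y * g y)%C x (l * g x + f x * m)%C.
Proof.
  intros Hf Hg.
  destruct (is_derive01_lipschitz_at g x m Hg) as [c [Hc0 Hc]].
  revert Hf Hg. rewrite !is_derive01_iff. intros Hf Hg eps Heps.
  set (A := Cmod (f x) + 1). set (B := Cmod (g x) + 1).
  set (K := (Cmod l + 1) * (Cmod m + 1)).
  pose proof (Cmod_ge_0 (f x)). pose proof (Cmod_ge_0 (g x)).
  pose proof (Cmod_ge_0 l). pose proof (Cmod_ge_0 m).
  assert (HA : 0 < A) by (unfold A; lra).
  assert (HB : 0 < B) by (unfold B; lra).
  assert (HK : 0 < K) by (unfold K; apply Rmult_lt_0_compat; lra).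
  destruct (is_derive01_lipschitz_at f x l) as [b [Hb0 Hb]].
  { apply is_derive01_iff. exact Hf. }
  destruct (Hf (eps/3/B)) as [d [Hd0 Hd]]; [apply Rdiv_lt_0_compat; lra|].
  destruct (Hg (eps/3/A)) as [e [He0 He]]; [apply Rdiv_lt_0_compat; lra|].
  (* The product of the two increments is quadratic in |y - x|; the bound [eps/3/K] turns it into a
     linear error. *)
  exists (Rmin (Rmin d e) (Rmin (Rmin b c) (eps/3/K))).
  assert (0 < eps/3/K) by (apply Rdiv_lt_0_compat; lra).
  split. { repeat apply Rmin_pos; assumption. }
  intros y Iy Hy.
  assert (Hy1 := Rlt_le_trans _ _ _ Hy (Rmin_l _ _)).
  assert (Hy2 := Rlt_le_trans _ _ _ Hy (Rmin_r _ _)).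
  assert (Hy3 := Rlt_le_trans _ _ _ Hy2 (Rmin_l _ _)).
  assert (Hy4 := Rlt_le_trans _ _ _ Hy2 (Rmin_r _ _)).
  specialize (Hd y Iy (Rlt_le_trans _ _ _ Hy1 (Rmin_l _ _))).
  specialize (He y Iy (Rlt_le_trans _ _ _ Hy1 (Rmin_r _ _))).
  specialize (Hb y Iy (Rlt_le_trans _ _ _ Hy3 (Rmin_l _ _))).
  specialize (Hc y Iy (Rlt_le_trans _ _ _ Hy3 (Rmin_r _ _))).
  replace (f y * g y - f x * g x - (l * g x + f x * m) * (y - x)%R)%C with
    ((f y - f x - l * (y - x)%R) * g x + f x * (g y - g x - m * (y - x)%R)
     + (f y - f x) * (g y - g x))%C by ring.
  set (t := Rabs (y - x)) in *.
  assert (Ht : 0 <= t) by apply Rabs_pos.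
  eapply Rle_trans; [apply Cmod_triangle|].
  eapply Rle_trans; [apply Rplus_le_compat_r, Cmod_triangle|].
  rewrite !Cmod_mult.
  assert (E1 : Cmod (f y - f x - l * (y - x)%R)%C * Cmod (g x) <= eps/3 * t).
  { apply Rle_trans with (eps/3/B * t * B).
    - apply Rmult_le_compat; try apply Cmod_ge_0; [exact Hd|unfold B; lra].
    - right. field. lra. }
  assert (E2 : Cmod (f x) * Cmod (g y - g x - m * (y - x)%R)%C <= eps/3 * t).
  { apply Rle_trans with (A * (eps/3/A * t)).
    - apply Rmult_le_compat; try apply Cmod_ge_0; [unfold A; lra|exact He].
    - right. field. lra. }
  assert (E3 : Cmod (f y - f x)%C * Cmod (g y - g x)%C <= eps/3 * t).
  { apply Rle_trans with (((Cmod l + 1) * t) * ((Cmod m + 1) * t)).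
    - apply Rmult_le_compat; try apply Cmod_ge_0; assumption.
    - apply Rle_trans with (K * (eps/3/K) * t).
      + replace ((Cmod l + 1) * t * ((Cmod m + 1) * t)) with (K * t * t)
          by (unfold K; ring).
        apply Rmult_le_compat_r; [exact Ht|].
        apply Rmult_le_compat_l; lra.
      + right. field. lra. }
  lra.
Qed.

Lemma is_derive01_comp (f : R -> C) (phi : R -> R) (x : R) (l m : C) :
  (forall y, I01 y -> I01 (phi y)) ->
  is_derive01 f (phi x) l -> is_derive01 (as_C phi) x m ->
  is_derive01 (fun y => f (phi y)) x (l * m)%C.
Proof.
  intros Hphi Hf Hp.
  destruct (is_derive01_lipschitz_at _ _ _ Hp) as [c [Hc0 Hc]].
  revert Hf Hp. rewrite !is_derive01_iff. intros Hf Hp eps Heps.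
  pose proof (Cmod_ge_0 l). pose proof (Cmod_ge_0 m).
  destruct (Hf (eps/2/(Cmod m + 1))) as [d [Hd0 Hd]];
    [apply Rdiv_lt_0_compat; lra|].
  destruct (Hp (eps/2/(Cmod l + 1))) as [e [He0 He]];
    [apply Rdiv_lt_0_compat; lra|].
  exists (Rmin (Rmin c e) (d / (Cmod m + 1))).
  split. { repeat apply Rmin_pos; try assumption. apply Rdiv_lt_0_compat; lra. }
  intros y Iy Hy.
  assert (Hy1 := Rlt_le_trans _ _ _ Hy (Rmin_l _ _)).
  assert (Hy2 := Rlt_le_trans _ _ _ Hy (Rmin_r _ _)).
  specialize (Hc y Iy (Rlt_le_trans _ _ _ Hy1 (Rmin_l _ _))).
  specialize (He y Iy (Rlt_le_trans _ _ _ Hy1 (Rmin_r _ _))).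
  unfold as_C in Hc, He. rewrite <- RtoC_minus, Cmod_R in Hc.
  set (t := Rabs (y - x)) in *.
  assert (Ht : 0 <= t) by apply Rabs_pos.
  assert (Hs : Rabs (phi y - phi x) < d).
  { apply Rle_lt_trans with (1 := Hc).
    apply Rlt_le_trans with ((Cmod m + 1) * (d / (Cmod m + 1))).
    - apply Rmult_lt_compat_l; lra.
    - right. field. lra. }
  specialize (Hd (phi y) (Hphi y Iy) Hs).
  replace (f (phi y) - f (phi x) - l * m * (y - x)%R)%C with
    ((f (phi y) - f (phi x) - l * (phi y - phi x)%R)
     + l * (phi y - phi x - m * (y - x)%R))%C by (rewrite !RtoC_minus; ring).
  eapply Rle_trans; [apply Cmod_triangle|]. rewrite Cmod_mult.
  assert (E1 : eps/2/(Cmod m + 1) * Rabs (phi y - phi x) <= eps/2 * t).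
  { apply Rle_trans with (eps/2/(Cmod m + 1) * ((Cmod m + 1) * t)).
    - apply Rmult_le_compat_l; [|exact Hc]. apply Rlt_le, Rdiv_lt_0_compat; lra.
    - right. field. lra. }
  assert (E2 : Cmod l * Cmod (phi y - phi x - m * (y - x)%R)%C <= eps/2 * t).
  { apply Rle_trans with ((Cmod l + 1) * (eps/2/(Cmod l + 1) * t)).
    - apply Rmult_le_compat; try apply Cmod_ge_0; [lra|exact He].
    - right. field. lra. }
  lra.
Qed.

Lemma is_derive01_shift (f : R -> C) (c x : R) (l : C) (r : R) :
  0 < r -> (forall y, Rabs (y - x) < r -> I01 (y + c)) ->
  is_derive01 f (x + c) l -> is_derive01 (fun y => f (y + c)%R) x l.
Proof.
  rewrite !is_derive01_iff. intros Hr Hc H eps Heps.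
  destruct (H eps Heps) as [d [Hd0 Hd]]. exists (Rmin d r).
  split; [apply Rmin_pos; assumption|].
  intros y Iy Hy.
  specialize (Hd (y + c)%R (Hc y (Rlt_le_trans _ _ _ Hy (Rmin_r _ _)))).
  replace (y + c - (x + c))%R with (y - x)%R in Hd by ring.
  apply Hd. eapply Rlt_le_trans; [exact Hy|apply Rmin_l].
Qed.

Lemma is_derive01_RtoC (f : R -> R) (x l : R) :
  is_derive f x l -> is_derive01 (fun y => RtoC (f y)) x (RtoC l).
Proof.
  rewrite is_derive_Reals, is_derive01_iff. intros H eps Heps.
  destruct (H eps Heps) as [d Hd]. exists d. split; [apply cond_pos|].
  intros y _ Hy. destruct (Req_dec y x) as [->|Hne].
  - rewrite Rminus_diag. replace (f x - f x - l * 0%R)%C with (RtoC 0) by ring.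
    rewrite Cmod_0, Rabs_R0. lra.
  - specialize (Hd (y - x) ltac:(lra) Hy).
    replace (x + (y - x)) with y in Hd by ring.
    rewrite <- !RtoC_minus, <- RtoC_mult, <- RtoC_minus, Cmod_R.
    replace (f y - f x - l * (y - x)) with
      (((f y - f x) / (y - x) - l) * (y - x)) by (field; lra).
    rewrite Rabs_mult. apply Rmult_le_compat_r; [apply Rabs_pos|lra].
Qed.

(** The retraction of the line onto [0,1]. Composing with it makes one-sided continuity at 0 and 1
    two-sided, the form that [bounded_continuity] asks for. *)
Definition clamp (x : R) : R := Rmax 0 (Rmin 1 x).

Lemma clamp_I01 (x : R) : I01 (clamp x).
Proof.
  unfold clamp, I01. split; [apply Rmax_l|].
  apply Rmax_lub; [lra|apply Rmin_l].
Qed.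

Lemma clamp_id (x : R) : I01 x -> clamp x = x.
Proof.
  unfold I01, clamp. intros H. rewrite Rmin_right, Rmax_right; lra.
Qed.

Lemma clamp_lipschitz (x y : R) : Rabs (clamp y - clamp x) <= Rabs (y - x).
Proof.
  assert (K : forall z, z <= 0 /\ clamp z = 0 \/ 0 <= z <= 1 /\ clamp z = z
    \/ 1 <= z /\ clamp z = 1).
  { intros z. unfold clamp. destruct (Rle_dec z 0); [|destruct (Rle_dec z 1)].
    - left. rewrite Rmin_right, Rmax_left; lra.
    - right; left. rewrite Rmin_right, Rmax_right; lra.
    - right; right. rewrite Rmin_left, Rmax_right; lra. }
  destruct (K x) as [[? ->]|[[? ->]|[? ->]]];
  destruct (K y) as [[? ->]|[[? ->]|[? ->]]];
  apply Rabs_le; unfold Rabs; destruct (Rcase_abs (y - x)); lra.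
Qed.

Lemma derivable01_bounded (f : R -> C) :
  (forall x, I01 x -> ex_derive01 f x) ->
  exists B, forall x, I01 x -> Cmod (f x) <= B.
Proof.
  intros H.
  destruct (@bounded_continuity R_AbsRing R_NormedModule
    (fun x => Cmod (f (clamp x))) 0 1) as [B HB].
  - intros x Hx. apply (filterlim_locally (T := R)).
    intros [eps Heps]. destruct (H (clamp x) (clamp_I01 x)) as [l Hl].
    destruct (is_derive01_lipschitz_at _ _ _ Hl) as [d [Hd0 Hd]].
    pose proof (Cmod_ge_0 l).
    assert (He : 0 < Rmin d (eps / (Cmod l + 1))).
    { apply Rmin_pos; [exact Hd0|apply Rdiv_lt_0_compat; lra]. }
    exists (mkposreal _ He). intros y Hy.
    change (Rabs (y - x) < Rmin d (eps / (Cmod l + 1))) in Hy.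
    change (Rabs (Cmod (f (clamp y)) - Cmod (f (clamp x))) < eps).
    assert (Hy1 := Rlt_le_trans _ _ _ Hy (Rmin_l _ _)).
    assert (Hy2 := Rlt_le_trans _ _ _ Hy (Rmin_r _ _)).
    pose proof (clamp_lipschitz x y).
    specialize (Hd (clamp y) (clamp_I01 y) ltac:(lra)).
    apply Rle_lt_trans with (Cmod (f (clamp y) - f (clamp x))%C).
    + pose proof (Cmod_triangle (f (clamp y) - f (clamp x))%C (f (clamp x))) as T1.
      pose proof (Cmod_triangle (f (clamp x) - f (clamp y))%C (f (clamp y))) as T2.
      replace (f (clamp y) - f (clamp x) + f (clamp x))%C with (f (clamp y)) in T1 by ring.
      replace (f (clamp x) - f (clamp y) + f (clamp y))%C with (f (clamp x)) in T2 by ring.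
      replace (f (clamp x) - f (clamp y))%C with (- (f (clamp y) - f (clamp x)))%C in T2 by ring.
      rewrite Cmod_opp in T2. apply Rabs_le. lra.
    + apply Rle_lt_trans with (1 := Hd).
      apply Rlt_le_trans with ((Cmod l + 1) * (eps / (Cmod l + 1))).
      * apply Rmult_lt_compat_l; lra.
      * right. field. lra.
  - exists B. intros x Ix. specialize (HB x Ix). rewrite clamp_id in HB by exact Ix.
    apply Rlt_le. apply Rle_lt_trans with (2 := HB). apply Rle_abs.
Qed.

Lemma supnorm01_le (f : R -> C) (B : R) :
  (forall x, I01 x -> Cmod (f x) <= B) -> 0 <= supnorm01 f <= B.
Proof.
  intros H. unfold supnorm01.
  set (E := fun r => _). destruct (Lub_Rbar_correct E) as [Hu Hl].
  assert (H0 : I01 0) by (unfold I01; lra).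
  assert (L : Rbar_le (Lub_Rbar E) B).
  { apply Hl. intros r [x [Ix ->]]. apply H. exact Ix. }
  assert (U : Rbar_le (Cmod (f 0)) (Lub_Rbar E)).
  { apply Hu. exists 0. split; [exact H0|reflexivity]. }
  pose proof (Cmod_ge_0 (f 0)).
  destruct (Lub_Rbar E) as [r| |]; simpl in *; try contradiction. lra.
Qed.

(** Some finite [B] must exist: [real] would send an infinite supremum to 0 and the inequality could
    fail. *)
Lemma le_supnorm01 (f : R -> C) (B x : R) :
  (forall x, I01 x -> Cmod (f x) <= B) -> I01 x -> Cmod (f x) <= supnorm01 f.
Proof.
  intros H Ix. unfold supnorm01.
  set (E := fun r => _). destruct (Lub_Rbar_correct E) as [Hu Hl].
  assert (L : Rbar_le (Lub_Rbar E) B).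
  { apply Hl. intros r [z [Iz ->]]. apply H. exact Iz. }
  assert (U : Rbar_le (Cmod (f x)) (Lub_Rbar E)).
  { apply Hu. exists x. split; [exact Ix|reflexivity]. }
  destruct (Lub_Rbar E) as [r| |]; simpl in *; try contradiction. exact U.
Qed.

(** An explicit family of derivatives, used as a certificate of smoothness: it can be checked by the
    rules of differentiation, whereas [Derive01_n] is a description. By uniqueness of derivatives
    the two agree on [0,1]. *)
Definition tower (f : R -> C) (F : nat -> R -> C) : Prop :=
  (forall x, I01 x -> F O x = f x) /\
  forall n x, I01 x -> is_derive01 (F n) x (F (S n) x).

Lemma tower_Derive01_n (f : R -> C) (F : nat -> R -> C) (n : nat) (x : R) :
  tower f F -> I01 x -> Derive01_n f n x = F n x.
Proof.
  intros [H0 HS]. revert x. induction n as [|n IH]; intros x Ix; simpl.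
  - symmetry. apply H0, Ix.
  - apply is_derive01_unique; [exact Ix|].
    apply (is_derive01_ext (F n)); [exact Ix| |apply HS, Ix].
    intros y Iy. symmetry. apply IH, Iy.
Qed.

Lemma tower_smooth01 (f : R -> C) (F : nat -> R -> C) : tower f F -> smooth01 f.
Proof.
  intros H n x Ix. exists (F (S n) x).
  apply (is_derive01_ext (F n)); [exact Ix| |apply (proj2 H), Ix].
  intros y Iy. symmetry. apply tower_Derive01_n; assumption.
Qed.

Lemma smooth01_tower (f : R -> C) : smooth01 f -> tower f (Derive01_n f).
Proof.
  intros H. split; [reflexivity|]. intros n x Ix.
  destruct (H n x Ix) as [l Hl]. simpl.
  rewrite (is_derive01_unique _ _ _ Ix Hl). exact Hl.
Qed.

Lemma tower_S (f : R -> C) (F : nat -> R -> C) :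
  tower f F -> tower (F 1%nat) (fun n => F (S n)).
Proof. intros [_ H]. split; [reflexivity|]. intros n x Ix. apply H, Ix. Qed.

(** * Bump functions *)

(** Averaging preserves the constant [K], and this one property yields continuity, integrability and
    the explicit error [K * a] of an average. *)
Definition lipschitz (K : R) (w : R -> R) : Prop :=
  forall x y, Rabs (w x - w y) <= K * Rabs (x - y).

Lemma lipschitz_nonneg (K : R) (w : R -> R) : lipschitz K w -> 0 <= K.
Proof.
  intros H. specialize (H 1 0). rewrite Rminus_0_r, Rabs_R1 in H.
  pose proof (Rabs_pos (w 1 - w 0)). lra.
Qed.

Lemma lipschitz_continuous (K : R) (w : R -> R) (x : R) :
  lipschitz K w -> continuous w x.
Proof.
  intros H. pose proof (lipschitz_nonneg K w H).
  apply (filterlim_locally (T := R)). intros [eps Heps].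
  assert (Hd : 0 < eps / (K + 1)) by (apply Rdiv_lt_0_compat; lra).
  exists (mkposreal _ Hd). intros y Hy. change (Rabs (w y - w x) < eps).
  change (Rabs (y - x) < eps / (K + 1)) in Hy.
  apply Rle_lt_trans with (1 := H y x).
  apply Rle_lt_trans with ((K + 1) * Rabs (y - x)).
  - pose proof (Rabs_pos (y - x)). nra.
  - replace eps with ((K + 1) * (eps / (K + 1))) by (field; lra).
    apply Rmult_lt_compat_l; lra.
Qed.

Lemma lipschitz_shift (K : R) (w : R -> R) (x : R) :
  lipschitz K w -> lipschitz K (fun t => w (x + t)).
Proof.
  intros H s t. eapply Rle_trans; [apply H|]. right. do 2 f_equal. ring.
Qed.

Lemma lipschitz_ex_RInt (K : R) (w : R -> R) (u v : R) :
  lipschitz K w -> ex_RInt w u v.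
Proof.
  intros H. apply (ex_RInt_continuous (V := R_CompleteNormedModule)). intros z _.
  apply (lipschitz_continuous K), H.
Qed.

(** Convolution of [w] with the uniform probability density on [-a, a]. *)
Definition box (a : R) (w : R -> R) (x : R) : R :=
  RInt (fun t => w (x + t)) (- a) a / (2 * a).

(* The derivative of [box a w]; it commutes with every [box]. *)
Definition diffquot (a : R) (w : R -> R) (x : R) : R :=
  (w (x + a) - w (x - a)) / (2 * a).

Lemma box_const (a c x : R) : 0 < a -> box a (fun _ => c) x = c.
Proof.
  intros Ha. unfold box. rewrite RInt_const. unfold scal; simpl.
  unfold mult; simpl. field. lra.
Qed.

Lemma lipschitz_const (c : R) : lipschitz 0 (fun _ => c).
Proof. intros x y. rewrite Rminus_diag, Rabs_R0. lra. Qed.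

(** An average is bounded by a bound on its integrand. Two functions and two base points are allowed
    so that [v = w] gives the Lipschitz bound, a constant [v] gives nearness to [w x] and vanishing,
    and [x = y] gives contraction in the sup norm. *)
Lemma box_close (a K K' B : R) (w v : R -> R) (x y : R) :
  0 < a -> lipschitz K w -> lipschitz K' v ->
  (forall t, - a <= t <= a -> Rabs (w (x + t) - v (y + t)) <= B) ->
  Rabs (box a w x - box a v y) <= B.
Proof.
  intros Ha Hw Hv H. unfold box.
  apply (lipschitz_shift _ _ x), (fun h => lipschitz_ex_RInt _ _ (- a) a h) in Hw.
  apply (lipschitz_shift _ _ y), (fun h => lipschitz_ex_RInt _ _ (- a) a h) in Hv.
  assert (E : RInt (fun t => w (x + t) - v (y + t)) (- a) a
    = RInt (fun t => w (x + t)) (- a) a - RInt (fun t => v (y + t)) (- a) a).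
  { exact (RInt_minus _ _ _ _ Hw Hv). }
  assert (I : ex_RInt (fun t => w (x + t) - v (y + t)) (- a) a).
  { exact (ex_RInt_minus _ _ _ _ Hw Hv). }
  unfold Rdiv. rewrite <- Rmult_minus_distr_r, <- E.
  rewrite Rabs_mult, (Rabs_pos_eq (/ (2 * a)))
    by (apply Rlt_le, Rinv_0_lt_compat; lra).
  apply Rmult_le_reg_r with (2 * a); [lra|].
  rewrite Rmult_assoc, Rinv_l, Rmult_1_r by lra.
  eapply Rle_trans; [apply (abs_RInt_le_const _ (- a) a B); [lra|exact I|exact H]|].
  right. ring.
Qed.

Lemma box_lipschitz (a K : R) (w : R -> R) :
  0 < a -> lipschitz K w -> lipschitz K (box a w).
Proof.
  intros Ha H x y. apply (box_close a K K); try assumption.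
  intros t _. eapply Rle_trans; [apply H|]. right. do 2 f_equal. ring.
Qed.

Lemma box_near (a K : R) (w : R -> R) (x : R) :
  0 < a -> lipschitz K w -> Rabs (box a w x - w x) <= K * a.
Proof.
  intros Ha H. rewrite <- (box_const a (w x) x Ha) at 1.
  apply (box_close a K 0); [exact Ha|exact H|apply lipschitz_const|].
  intros t Ht. eapply Rle_trans; [apply H|].
  apply Rmult_le_compat_l; [apply (lipschitz_nonneg K w H)|].
  apply Rabs_le. lra.
Qed.

Lemma box_vanish (a K : R) (w : R -> R) (x : R) :
  0 < a -> lipschitz K w -> (forall t, - a <= t <= a -> w (x + t) = 0) ->
  box a w x = 0.
Proof.
  intros Ha H H0.
  assert (E := box_close a K 0 0 w (fun _ => 0) x x Ha H (lipschitz_const 0)).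
  rewrite box_const, Rminus_0_r in E by exact Ha.
  apply Rabs_eq_0. apply Rle_antisym; [|apply Rabs_pos]. apply E.
  intros t Ht. rewrite (H0 t Ht), Rminus_0_r, Rabs_R0. lra.
Qed.

Lemma box_diffquot (a b K : R) (w : R -> R) (x : R) :
  lipschitz K w -> box a (diffquot b w) x = diffquot b (box a w) x.
Proof.
  intros Hw. unfold box, diffquot.
  assert (H1 := lipschitz_ex_RInt _ _ (- a) a (lipschitz_shift _ _ (x + b) Hw)).
  assert (H2 := lipschitz_ex_RInt _ _ (- a) a (lipschitz_shift _ _ (x - b) Hw)).
  assert (E1 := RInt_minus _ _ _ _ H1 H2).
  assert (E2 := RInt_scal _ (- a) a (/ (2 * b)) (ex_RInt_minus _ _ _ _ H1 H2)).
  assert (E3 := eq_trans E2 (f_equal (scal (/ (2 * b))) E1)).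
  rewrite (RInt_ext _ (fun t => scal (/ (2 * b))
    (minus (w (x + b + t)) (w (x - b + t))))).
  - etransitivity; [apply (f_equal (fun u => u / (2 * a)) E3)|]. unfold scal, minus, plus, opp; simpl. unfold mult; simpl.
    unfold Rdiv. ring.
  - intros t _. unfold scal, minus, plus, opp; simpl. unfold mult; simpl.
    replace (x + t + b) with (x + b + t) by ring.
    replace (x + t - b) with (x - b + t) by ring.
    unfold Rdiv. ring.
Qed.

(** Substituting z = x + t moves the variable from the integrand to the endpoints, so the average is
    a difference of two values of a primitive [G]. *)
Lemma box_is_derive (a K : R) (w : R -> R) (x : R) :
  lipschitz K w -> is_derive (box a w) x (diffquot a w x).
Proof.
  intros H.
  assert (I := fun u v => lipschitz_ex_RInt K w u v H).
  set (G := fun z => RInt w 0 z).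
  assert (HG : forall z, is_derive G z (w z)).
  { intros z. apply (is_derive_RInt w G 0 z).
    - apply filter_forall. intros y. apply (RInt_correct (V := R_CompleteNormedModule)), I.
    - apply (lipschitz_continuous K), H. }
  apply (is_derive_ext (fun y => (G (y + a) - G (y - a)) / (2 * a))).
  - intros y. unfold box. f_equal.
    assert (E := RInt_comp_lin w 1 y (- a) a (I _ _)).
    rewrite (RInt_ext _ (fun t => w (y + t))) in E.
    2:{ intros t _. unfold scal; simpl. unfold mult; simpl. rewrite !Rmult_1_l.
        f_equal. ring. }
    rewrite E.
    assert (E2 := RInt_Chasles w 0 (y - a) (y + a) (I _ _) (I _ _)).
    unfold G. rewrite <- E2. unfold plus; simpl.
    replace (1 * - a + y) with (y - a) by ring.
    replace (1 * a + y) with (y + a) by ring. ring.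
  - assert (D1 : is_derive (fun y => G (y + a)) x (w (x + a))).
    { evar_last. apply (is_derive_comp G (fun y => y + a)); [apply HG|].
      auto_derive; [exact Logic.I|reflexivity].
      unfold scal; simpl. unfold mult; simpl. ring. }
    assert (D2 : is_derive (fun y => G (y - a)) x (w (x - a))).
    { evar_last. apply (is_derive_comp G (fun y => y - a)); [apply HG|].
      auto_derive; [exact Logic.I|reflexivity].
      unfold scal; simpl. unfold mult; simpl. ring. }
    assert (D3 := is_derive_scal _ _ (/ (2 * a)) _ (is_derive_minus _ _ _ _ _ D1 D2)).
    unfold diffquot. evar_last.
    + eapply is_derive_ext; [|exact D3]. intros t. simpl.
      unfold minus, plus, opp; simpl. unfold Rdiv. ring.
    + unfold minus, plus, opp; simpl. unfold Rdiv. ring.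
Qed.

Lemma diffquot_lipschitz (a K : R) (w : R -> R) :
  0 < a -> lipschitz K w -> lipschitz (K / a) (diffquot a w).
Proof.
  intros Ha H x y. unfold diffquot.
  assert (H1 := H (x + a) (y + a)). assert (H2 := H (x - a) (y - a)).
  replace (x + a - (y + a)) with (x - y) in H1 by ring.
  replace (x - a - (y - a)) with (x - y) in H2 by ring.
  replace ((w (x + a) - w (x - a)) / (2 * a) - (w (y + a) - w (y - a)) / (2 * a))
    with (((w (x + a) - w (y + a)) - (w (x - a) - w (y - a))) / (2 * a))
    by (field; lra).
  unfold Rdiv at 1. rewrite Rabs_mult, (Rabs_pos_eq (/ (2 * a)))
    by (apply Rlt_le, Rinv_0_lt_compat; lra).
  apply Rle_trans with (2 * (K * Rabs (x - y)) * / (2 * a)).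
  - apply Rmult_le_compat_r; [apply Rlt_le, Rinv_0_lt_compat; lra|].
    eapply Rle_trans; [apply Rabs_triang|]. rewrite Rabs_Ropp. lra.
  - right. field. lra.
Qed.

Lemma diffquot_bound (a B : R) (w : R -> R) :
  0 < a -> (forall x, Rabs (w x) <= B) -> forall x, Rabs (diffquot a w x) <= B / a.
Proof.
  intros Ha H x. unfold diffquot, Rdiv at 1.
  rewrite Rabs_mult, (Rabs_pos_eq (/ (2 * a)))
    by (apply Rlt_le, Rinv_0_lt_compat; lra).
  apply Rle_trans with (2 * B * / (2 * a)).
  - apply Rmult_le_compat_r; [apply Rlt_le, Rinv_0_lt_compat; lra|].
    eapply Rle_trans; [apply Rabs_triang|]. rewrite Rabs_Ropp.
    pose proof (H (x + a)). pose proof (H (x - a)). lra.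
  - right. field. lra.
Qed.

Section InfiniteConvolution.

Variable a : nat -> R.
Hypothesis a_pos : forall n, 0 < a n.
Hypothesis a_sum : ex_series a.

Definition tail (n : nat) : R := Series (fun j => a (n + j)%nat).

Lemma tail_S (n : nat) : tail n = a n + tail (S n).
Proof.
  unfold tail. rewrite Series_incr_1.
  - rewrite Nat.add_0_r. f_equal. apply Series_ext. intros k. f_equal. lia.
  - apply (ex_series_incr_n a n), a_sum.
Qed.

Lemma tail_nonneg (n : nat) : 0 <= tail n.
Proof.
  replace 0 with (Series (fun k => 0 * a k)).
  - apply Series_le.
    + intros k. rewrite Rmult_0_l. split; [lra|apply Rlt_le, a_pos].
    + apply (ex_series_incr_n a n), a_sum.
  - rewrite Series_scal_l. ring.
Qed.

Lemma tail_sum (n : nat) : tail 0 = sum_f_R0 a n + tail (S n).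
Proof.
  induction n as [|n IH].
  - apply tail_S.
  - rewrite IH, (tail_S (S n)). simpl. ring.
Qed.

Lemma tail_small (eps : R) : 0 < eps -> exists n, forall m, (n <= m)%nat -> tail m < eps.
Proof.
  intros Heps. assert (H := Series_correct _ a_sum).
  destruct (H (fun y => Rabs (y - Series a) < eps)) as [N HN].
  { exists (mkposreal eps Heps). intros y Hy. exact Hy. }
  exists (S N). intros [|m] Hm; [lia|]. specialize (HN m ltac:(lia)). cbv beta in HN.
  rewrite sum_n_Reals in HN.
  assert (E := tail_sum m). unfold tail at 1 in E. simpl in E.
  change (fun j : nat => a j) with a in E. rewrite E in HN.
  apply Rabs_def2 in HN. lra.
Qed.

(** Half-width [a k] is outermost, so that the limit in [m] can be differentiated by peeling off its
    first average, while passing from [m] to [S m] only inserts a new average next to [w]. *)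
Fixpoint iterbox (k m : nat) (w : R -> R) : R -> R :=
  match m with
  | O => w
  | S m' => box (a k) (iterbox (S k) m' w)
  end.

Lemma iterbox_S (k m : nat) (w : R -> R) :
  iterbox k (S m) w = iterbox k m (box (a (k + m)) w).
Proof.
  revert k. induction m as [|m IH]; intros k.
  - simpl. rewrite Nat.add_0_r. reflexivity.
  - change (iterbox k (S (S m)) w) with (box (a k) (iterbox (S k) (S m) w)).
    rewrite IH. replace (k + S m)%nat with (S k + m)%nat by lia. reflexivity.
Qed.

Lemma iterbox_lipschitz (k m : nat) (K : R) (w : R -> R) :
  lipschitz K w -> lipschitz K (iterbox k m w).
Proof.
  intros H. revert k. induction m as [|m IH]; intros k; simpl; [exact H|].
  apply box_lipschitz; [apply a_pos|apply IH].
Qed.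

Lemma iterbox_close (k m : nat) (K K' B : R) (w v : R -> R) :
  lipschitz K w -> lipschitz K' v -> (forall x, Rabs (w x - v x) <= B) ->
  forall x, Rabs (iterbox k m w x - iterbox k m v x) <= B.
Proof.
  intros Hw Hv H. revert k. induction m as [|m IH]; intros k; simpl; [exact H|].
  intros x. apply (box_close _ K K'); try apply iterbox_lipschitz; auto.
Qed.

Lemma iterbox_zero (k m : nat) (x : R) : iterbox k m (fun _ => 0) x = 0.
Proof.
  revert k x. induction m as [|m IH]; intros k x; simpl; [reflexivity|].
  apply (box_vanish _ 0); [apply a_pos| |intros; apply IH].
  apply iterbox_lipschitz, lipschitz_const.
Qed.

(** Each extra average acts directly on [w] and moves it by at most [K] times its half-width; the
    outer averages do not increase sup distances. *)
Lemma iterbox_cauchy (k m p : nat) (K : R) (w : R -> R) (x : R) :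
  lipschitz K w ->
  Rabs (iterbox k (m + p) w x - iterbox k m w x) <= K * (tail (k + m) - tail (k + m + p)).
Proof.
  intros H. induction p as [|p IH].
  - rewrite !Nat.add_0_r, !Rminus_diag, Rabs_R0. lra.
  - replace (m + S p)%nat with (S (m + p)) by lia.
    rewrite iterbox_S.
    assert (E := iterbox_close k (m + p) K K (K * a (k + (m + p)))
      (box (a (k + (m + p))) w) w (box_lipschitz _ _ _ (a_pos _) H) H
      (fun y => box_near _ _ _ y (a_pos _) H) x).
    assert (T := tail_S (k + m + p)).
    replace (k + (m + p))%nat with (k + m + p)%nat in * by lia.
    replace (k + m + S p)%nat with (S (k + m + p)) by lia.
    rewrite T in IH.
    match goal with |- Rabs (?u - ?v) <= _ =>
      replace (u - v) with ((u - iterbox k (m + p) w x) + (iterbox k (m + p) w x - v))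
        by ring end.
    eapply Rle_trans; [apply Rabs_triang|].
    lra.
Qed.

Definition convol (k : nat) (w : R -> R) (x : R) : R :=
  real (Lim_seq (fun m => iterbox k m w x)).

Lemma convol_is_lim (k : nat) (K : R) (w : R -> R) (x : R) :
  lipschitz K w -> is_lim_seq (fun m => iterbox k m w x) (convol k w x).
Proof.
  intros H. apply Lim_seq_correct', ex_lim_seq_cauchy_corr.
  pose proof (lipschitz_nonneg K w H) as HK.
  intros [eps Heps].
  (* [K] may be 0, hence [K + 1] in the denominator. *)
  destruct (tail_small (eps / (2 * (K + 1)))) as [N HN].
  { apply Rdiv_lt_0_compat; lra. }
  exists N. intros n m Hn Hm.
  assert (E := fun p => iterbox_cauchy k N p K w x H).
  assert (E1 := E (n - N)%nat). assert (E2 := E (m - N)%nat).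
  replace (N + (n - N))%nat with n in E1 by lia.
  replace (N + (m - N))%nat with m in E2 by lia.
  pose proof (tail_nonneg (k + N + (n - N))). pose proof (tail_nonneg (k + N + (m - N))).
  specialize (HN (k + N)%nat ltac:(lia)).
  assert (HB : 2 * (K * tail (k + N)) < eps).
  { pose proof (tail_nonneg (k + N)).
    apply Rle_lt_trans with (2 * (K + 1) * tail (k + N)); [nra|].
    replace eps with (2 * (K + 1) * (eps / (2 * (K + 1)))) by (field; lra).
    apply Rmult_lt_compat_l; lra. }
  replace (iterbox k n w x - iterbox k m w x) with
    ((iterbox k n w x - iterbox k N w x) - (iterbox k m w x - iterbox k N w x)) by ring.
  eapply Rle_lt_trans; [apply Rabs_triang|]. rewrite Rabs_Ropp. simpl.
  apply Rle_lt_trans with (2 * (K * tail (k + N))); [nra|exact HB].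
Qed.

Lemma is_lim_seq_abs_le (u : nat -> R) (l c B : R) :
  is_lim_seq u l -> (forall n, Rabs (u n - c) <= B) -> Rabs (l - c) <= B.
Proof.
  intros H HB.
  assert (H2 : is_lim_seq (fun n => Rabs (u n - c)) (Rabs (l - c))).
  { apply (is_lim_seq_abs _ (l - c)).
    apply is_lim_seq_minus'; [exact H|apply is_lim_seq_const]. }
  exact (is_lim_seq_le _ (fun _ => B) _ B HB H2 (is_lim_seq_const B)).
Qed.

Lemma convol_near (k m : nat) (K : R) (w : R -> R) (x : R) :
  lipschitz K w -> Rabs (convol k w x - iterbox k m w x) <= K * tail (k + m).
Proof.
  intros H. pose proof (lipschitz_nonneg K w H).
  apply (is_lim_seq_abs_le (fun p => iterbox k (p + m) w x)).
  - apply (is_lim_seq_incr_n (fun p => iterbox k p w x)).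
    apply (convol_is_lim k K), H.
  - intros p. rewrite Nat.add_comm. eapply Rle_trans; [apply iterbox_cauchy, H|].
    pose proof (tail_nonneg (k + m + p)). nra.
Qed.

Lemma convol_lipschitz (k : nat) (K : R) (w : R -> R) :
  lipschitz K w -> lipschitz K (convol k w).
Proof.
  intros H x y.
  assert (L : is_lim_seq (fun m => iterbox k m w x - iterbox k m w y)
    (convol k w x - convol k w y)).
  { apply is_lim_seq_minus'; apply (convol_is_lim k K), H. }
  rewrite <- (Rminus_0_r (convol k w x - convol k w y)).
  apply (is_lim_seq_abs_le _ _ _ _ L).
  intros n. rewrite Rminus_0_r. apply iterbox_lipschitz, H.
Qed.

Lemma convol_bound (k : nat) (K B : R) (w : R -> R) (x : R) :
  lipschitz K w -> (forall y, Rabs (w y) <= B) -> Rabs (convol k w x) <= B.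
Proof.
  intros H HB. rewrite <- (Rminus_0_r (convol k w x)).
  apply (is_lim_seq_abs_le _ _ _ _ (convol_is_lim k K w x H)).
  intros n. rewrite <- (iterbox_zero k n x) at 1.
  apply (iterbox_close k n K 0); [exact H|apply lipschitz_const|].
  intros y. rewrite Rminus_0_r. apply HB.
Qed.

(** The limit passes under the integral because [convol_near] is uniform in the point: both sides
    lie within [K * tail (S k + m)] of [iterbox k (S m) w x], for every [m]. *)
Lemma convol_box (k : nat) (K : R) (w : R -> R) (x : R) :
  lipschitz K w -> convol k w x = box (a k) (convol (S k) w) x.
Proof.
  intros H. pose proof (lipschitz_nonneg K w H).
  apply Rminus_diag_uniq, Rabs_eq_0.
  apply Rle_antisym; [|apply Rabs_pos]. apply Rnot_lt_le. intros Hd.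
  set (d := Rabs (convol k w x - box (a k) (convol (S k) w) x)) in *.
  destruct (tail_small (d / (2 * (K + 1)))) as [m Hm].
  { apply Rdiv_lt_0_compat; lra. }
  assert (E1 := convol_near k (S m) K w x H).
  assert (E2 : Rabs (iterbox k (S m) w x - box (a k) (convol (S k) w) x)
    <= K * tail (S k + m)).
  { simpl iterbox. apply (box_close _ K K).
    - apply a_pos.
    - apply iterbox_lipschitz, H.
    - apply convol_lipschitz, H.
    - intros t _. rewrite Rabs_minus_sym. apply convol_near, H. }
  replace (k + S m)%nat with (S k + m)%nat in E1 by lia.
  specialize (Hm (S k + m)%nat ltac:(lia)).
  assert (d <= 2 * (K * tail (S k + m))).
  { unfold d. replace (convol k w x - box (a k) (convol (S k) w) x) with
      ((convol k w x - iterbox k (S m) w x)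
       + (iterbox k (S m) w x - box (a k) (convol (S k) w) x)) by ring.
    eapply Rle_trans; [apply Rabs_triang|]. lra. }
  assert (2 * (K + 1) * tail (S k + m) < d).
  { apply Rlt_le_trans with (2 * (K + 1) * (d / (2 * (K + 1)))).
    - apply Rmult_lt_compat_l; lra.
    - right. field. lra. }
  pose proof (tail_nonneg (S k + m)). nra.
Qed.

Lemma iterbox_diffquot (k m : nat) (b K : R) (w : R -> R) (x : R) :
  0 < b -> lipschitz K w ->
  iterbox k m (diffquot b w) x = diffquot b (iterbox k m w) x.
Proof.
  intros Hb H. revert k x. induction m as [|m IH]; intros k x; simpl; [reflexivity|].
  rewrite <- (box_diffquot (a k) b K) by (apply iterbox_lipschitz, H).
  unfold box. f_equal. apply RInt_ext. intros t _. apply IH.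
Qed.

Lemma convol_diffquot (k : nat) (b K : R) (w : R -> R) (x : R) :
  0 < b -> lipschitz K w -> convol k (diffquot b w) x = diffquot b (convol k w) x.
Proof.
  intros Hb H.
  assert (L := convol_is_lim k _ _ x (diffquot_lipschitz b K w Hb H)).
  assert (L2 : is_lim_seq (fun m => iterbox k m (diffquot b w) x)
    (diffquot b (convol k w) x)).
  { apply (is_lim_seq_ext (fun m =>
      / (2 * b) * (iterbox k m w (x + b) - iterbox k m w (x - b)))).
    - intros m. rewrite (iterbox_diffquot k m b K) by assumption.
      unfold diffquot, Rdiv. ring.
    - replace (diffquot b (convol k w) x) with
        (/ (2 * b) * (convol k w (x + b) - convol k w (x - b)))
        by (unfold diffquot, Rdiv; ring).
      apply (is_lim_seq_scal_l _ (/ (2 * b))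
        (convol k w (x + b) - convol k w (x - b))).
      apply is_lim_seq_minus'; apply (convol_is_lim k K), H. }
  assert (U := is_lim_seq_unique _ _ L). rewrite (is_lim_seq_unique _ _ L2) in U.
  injection U as U. symmetry. exact U.
Qed.

(** The outermost average is spent on the derivative, and the resulting difference quotient moves
    under the remaining averages, which commute with it. The right-hand side has the same shape, one
    index later, so this iterates. *)
Lemma convol_is_derive (k : nat) (K : R) (w : R -> R) (x : R) :
  lipschitz K w ->
  is_derive (convol k w) x (convol (S k) (diffquot (a k) w) x).
Proof.
  intros H. rewrite (convol_diffquot (S k) (a k) K) by (auto).
  apply (is_derive_ext (box (a k) (convol (S k) w))).
  - intros t. symmetry. apply (convol_box k K), H.
  - apply (box_is_derive _ K), convol_lipschitz, H.
Qed.

(** Every average enlarges the support by its half-width, [tail k] in total. *)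
Lemma convol_support (k : nat) (K c r : R) (w : R -> R) (x : R) :
  lipschitz K w -> (forall y, r <= Rabs (y - c) -> w y = 0) ->
  r + tail k <= Rabs (x - c) -> convol k w x = 0.
Proof.
  intros H H0 Hx.
  assert (E : forall m, iterbox k m w x = 0).
  { intros m. revert k x Hx. induction m as [|m IH]; intros k x Hx; simpl.
    - apply H0. pose proof (tail_nonneg k). lra.
    - apply (box_vanish _ K); [apply a_pos|apply iterbox_lipschitz, H|].
      intros t Ht. apply IH. rewrite tail_S in Hx.
      pose proof (Rabs_triang (x + t - c) (- t)) as T. rewrite Rabs_Ropp in T.
      replace (x + t - c + - t) with (x - c) in T by ring.
      assert (Rabs t <= a k) by (apply Rabs_le; lra). lra. }
  unfold convol. rewrite (Lim_seq_ext _ (fun _ => 0)) by exact E.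
  rewrite Lim_seq_const. reflexivity.
Qed.

(* The [n]-th derivative of [convol 0 w] is [convol n (iterdiff n w)]. *)
Fixpoint iterdiff (n : nat) (w : R -> R) : R -> R :=
  match n with
  | O => w
  | S n' => diffquot (a n') (iterdiff n' w)
  end.

Fixpoint prodn (n : nat) : R :=
  match n with
  | O => 1
  | S n' => prodn n' * a n'
  end.

Lemma prodn_pos (n : nat) : 0 < prodn n.
Proof.
  induction n as [|n IH]; simpl; [lra|]. apply Rmult_lt_0_compat; auto.
Qed.

Lemma iterdiff_lipschitz (n : nat) (K : R) (w : R -> R) :
  lipschitz K w -> lipschitz (K / prodn n) (iterdiff n w).
Proof.
  intros H. induction n as [|n IH]; simpl.
  - rewrite Rdiv_1_r. exact H.
  - apply (diffquot_lipschitz (a n)) in IH; [|apply a_pos].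
    replace (K / (prodn n * a n)) with (K / prodn n / a n); [exact IH|].
    pose proof (prodn_pos n). pose proof (a_pos n). field. lra.
Qed.

Lemma iterdiff_bound (n : nat) (B : R) (w : R -> R) :
  (forall x, Rabs (w x) <= B) -> forall x, Rabs (iterdiff n w x) <= B / prodn n.
Proof.
  intros H. induction n as [|n IH]; simpl; intros x.
  - rewrite Rdiv_1_r. apply H.
  - replace (B / (prodn n * a n)) with (B / prodn n / a n).
    + apply diffquot_bound; [apply a_pos|exact IH].
    + pose proof (prodn_pos n). pose proof (a_pos n). field. lra.
Qed.

Lemma convolution_bump (c eta : R) :
  Series a < eta ->
  exists X : nat -> R -> R,
    (forall n x, is_derive (X n) x (X (S n) x)) /\
    (forall n x, Rabs (X n x) <= eta / prodn n) /\
    (forall x, 2 * eta <= Rabs (x - c) -> X O x = 0) /\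
    0 < X O c.
Proof.
  intros Heta. change (tail 0 < eta) in Heta.
  pose proof (tail_nonneg 0) as HT.
  (* A tent of slope 1, height [eta] and radius [eta]. The averages move its peak by at most
     [tail 0 < eta], so the value at [c] stays positive, and the support stays within radius
     [2 * eta]. *)
  set (w := fun x => Rmax 0 (eta - Rabs (x - c))).
  assert (Hw : lipschitz 1 w).
  { intros x y. unfold w.
    pose proof (Rabs_triang (x - y) (y - c)) as T1.
    pose proof (Rabs_triang (y - x) (x - c)) as T2.
    replace (x - y + (y - c)) with (x - c) in T1 by ring.
    replace (y - x + (x - c)) with (y - c) in T2 by ring.
    rewrite (Rabs_minus_sym y x) in T2. pose proof (Rabs_pos (x - y)).
    apply Rabs_le.
    destruct (Rle_dec 0 (eta - Rabs (x - c)));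
    destruct (Rle_dec 0 (eta - Rabs (y - c)));
    rewrite ?(Rmax_right 0 (eta - Rabs (x - c))), ?(Rmax_right 0 (eta - Rabs (y - c))),
      ?(Rmax_left 0 (eta - Rabs (x - c))), ?(Rmax_left 0 (eta - Rabs (y - c))) by lra;
    lra. }
  assert (HB : forall x, Rabs (w x) <= eta).
  { intros x. unfold w. rewrite Rabs_pos_eq by apply Rmax_l.
    pose proof (Rabs_pos (x - c)). apply Rmax_lub; lra. }
  exists (fun n => convol n (iterdiff n w)). split; [|split; [|split]].
  - intros n x. apply (convol_is_derive n (1 / prodn n)), iterdiff_lipschitz, Hw.
  - intros n x. apply (convol_bound n (1 / prodn n)).
    + apply iterdiff_lipschitz, Hw.
    + apply iterdiff_bound, HB.
  - intros x Hx. apply (convol_support 0 1 c eta); [exact Hw| |lra].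
    intros y Hy. unfold w. apply Rmax_left. lra.
  - assert (E := convol_near 0 0 1 w c Hw). simpl in E |- *.
    assert (w c = eta).
    { unfold w. rewrite Rminus_diag, Rabs_R0, Rmax_right; lra. }
    apply Rabs_le_between in E. lra.
Qed.

End InfiniteConvolution.

(* The widths are [2 * M n / M (S n)] from some rank on, and tiny before it: the
   factor 2 makes the series geometric, and the tiny widths make the support small. *)
Lemma bump_widths (M : nat -> R) (eta : R) :
  (forall n, 0 < M n) -> ex_series (fun n => M n / M (S n)) -> 0 < eta ->
  exists a : nat -> R, (forall n, 0 < a n) /\ ex_series a /\ Series a < eta /\
    ex_series (fun n => eta / prodn a n / M n).
Proof.
  intros HM Hm Heta. set (m := fun n => M n / M (S n)) in *.
  assert (m_pos : forall n, 0 < m n) by (intros; apply Rdiv_lt_0_compat; apply HM).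
  destruct (tail_small m Hm (eta / 4)) as [N HN]; [lra|].
  specialize (HN (S N) ltac:(lia)).
  assert (Sm := tail_sum m Hm N).
  pose proof (tail_nonneg m m_pos Hm 0) as T0.
  pose proof (tail_nonneg m m_pos Hm (S N)) as TN.
  set (s := tail m 0) in *.
  (* Half of [eta] goes to each piece: the head contributes at most [delta * s], and the rest
     [2 * tail m (S N)], where [tail m (S N) < eta / 4]. *)
  set (delta := eta / (2 * (s + 1))).
  assert (Hdelta : 0 < delta) by (apply Rdiv_lt_0_compat; lra).
  set (rho := fun n => if (n <=? N)%nat then delta else 2).
  assert (rho_pos : forall n, 0 < rho n <= 2 + delta).
  { intros n. unfold rho. destruct (n <=? N)%nat; lra. }
  set (a := fun n => rho n * m n).
  assert (a_pos : forall n, 0 < a n).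
  { intros n. apply Rmult_lt_0_compat; [apply rho_pos|apply m_pos]. }
  assert (a_sum : ex_series a).
  { apply (@ex_series_le R_AbsRing R_CompleteNormedModule a
      (fun n => (2 + delta) * m n)).
    - intros n. change (Rabs (a n) <= (2 + delta) * m n).
      rewrite Rabs_pos_eq by (apply Rlt_le, a_pos).
      apply Rmult_le_compat_r; [apply Rlt_le, m_pos|apply rho_pos].
    - apply (ex_series_scal_l (2 + delta) m Hm). }
  exists a. split; [exact a_pos|]. split; [exact a_sum|]. split.
  - change (tail a 0 < eta). rewrite (tail_sum a a_sum N).
    assert (E1 : sum_f_R0 a N = delta * sum_f_R0 m N).
    { rewrite scal_sum. apply sum_eq.
      intros n Hn. unfold a, rho. destruct (Nat.leb_spec n N); [ring|lia]. }
    assert (E2 : tail a (S N) = 2 * tail m (S N)).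
    { unfold tail. rewrite <- Series_scal_l. apply Series_ext. intros n.
      unfold a, rho. destruct (Nat.leb_spec (S N + n) N); [lia|reflexivity]. }
    rewrite E1, E2.
    assert (delta * sum_f_R0 m N < eta / 2).
    { apply Rlt_le_trans with (delta * (s + 1)).
      - apply Rmult_lt_compat_l; lra.
      - right. unfold delta. field. lra. }
    lra.
  - apply (ex_series_incr_n _ (S N)).
    (* Telescoping: beyond rank [N] one has a_n M_(n+1) = 2 M_n, so each step doubles the left-hand
       side. *)
    assert (P : forall k, prodn a (S N + k) * M (S N + k)%nat
      = prodn a (S N) * M (S N) * 2 ^ k).
    { induction k as [|k IH].
      - rewrite Nat.add_0_r. simpl pow. ring.
      - replace (S N + S k)%nat with (S (S N + k)) by lia.
        change (prodn a (S (S N + k))) with (prodn a (S N + k) * a (S N + k)%nat).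
        simpl pow. replace (prodn a (S N) * M (S N) * (2 * 2 ^ k)) with
          (2 * (prodn a (S N + k) * M (S N + k)%nat)) by (rewrite IH; ring).
        unfold a at 2. unfold rho, m.
        destruct (Nat.leb_spec (S N + k) N); [lia|].
        pose proof (HM (S (S N + k))). field. lra. }
    apply (ex_series_ext (fun k => eta / (prodn a (S N) * M (S N)) * (/ 2) ^ k)).
    + intros k.
      pose proof (prodn_pos a a_pos (S N + k)). pose proof (HM (S N + k)%nat).
      pose proof (prodn_pos a a_pos (S N)). pose proof (HM (S N)).
      replace (eta / prodn a (S N + k) / M (S N + k)%nat) with
        (eta / (prodn a (S N + k) * M (S N + k)%nat)) by (field; lra).
      rewrite P, pow_inv. pose proof (pow_lt 2 k ltac:(lra)).
      match goal with |- ?u = ?v => change (@eq R u v) end. field. repeat split; lra.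
    + apply (ex_series_scal_l (eta / (prodn a (S N) * M (S N))) (fun k => (/ 2) ^ k)).
      apply ex_series_geom. rewrite Rabs_pos_eq; lra.
Qed.

(** The strict inequality describes an open set, so [f] vanishes near [x]. Induction extends the
    vanishing to all derivatives of the bump. *)
Lemma is_derive_zero_outside (f : R -> R) (c r x l : R) :
  (forall y, r < Rabs (y - c) -> f y = 0) -> is_derive f x l ->
  r < Rabs (x - c) -> l = 0.
Proof.
  intros H Hf Hx. apply is_derive_unique in Hf. rewrite <- Hf.
  rewrite (Derive_ext_loc f (fun _ => 0)); [apply Derive_const|].
  assert (Hd : 0 < Rabs (x - c) - r) by lra.
  exists (mkposreal _ Hd). intros y Hy. apply H.
  change (Rabs (y - x) < Rabs (x - c) - r) in Hy.
  pose proof (Rabs_triang (x - y) (y - c)) as T.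
  replace (x - y + (y - c)) with (x - c) in T by ring.
  rewrite (Rabs_minus_sym x y) in T. lra.
Qed.

Lemma denjoy_carleman_bump (M : nat -> R) (c r : R) :
  (forall n, 0 < M n) -> ex_series (fun n => M n / M (S n)) -> 0 < r ->
  exists (X : nat -> R -> R) (B : nat -> R),
    (forall n x, is_derive (X n) x (X (S n) x)) /\
    (forall n x, Rabs (X n x) <= B n) /\
    ex_series (fun n => B n / M n) /\
    (forall n x, r < Rabs (x - c) -> X n x = 0) /\
    X O c = 1.
Proof.
  intros HM Hm Hr. set (eta := r / 2).
  destruct (bump_widths M eta HM Hm) as (a & a_pos & a_sum & Ha & HB);
    [unfold eta; lra|].
  destruct (convolution_bump a a_pos a_sum c eta Ha) as (X & XD & XB & XS & X1).
  (* Normalizing the value at [c] to 1 makes multiplication by the bump preserve the leading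
     coefficient of a jet at [c]. *)
  set (q := / X O c). assert (Hq : 0 < q) by (apply Rinv_0_lt_compat, X1).
  exists (fun n x => q * X n x), (fun n => q * (eta / prodn a n)).
  assert (D : forall n x, is_derive (fun x => q * X n x) x (q * X (S n) x)).
  { intros n x. apply (is_derive_scal (X n)), XD. }
  split; [exact D|]. split; [|split; [|split]].
  - intros n x. rewrite Rabs_mult, (Rabs_pos_eq q) by lra.
    apply Rmult_le_compat_l; [lra|apply XB].
  - apply (ex_series_ext (fun n => q * (eta / prodn a n / M n))).
    + intros n. symmetry. apply Rmult_assoc.
    + apply (ex_series_scal_l q (fun n => eta / prodn a n / M n) HB).
  - intros n. induction n as [|n IH]; intros x Hx.
    + rewrite XS; [ring|]. unfold eta. lra.
    + exact (is_derive_zero_outside _ c r x _ IH (D n x) Hx).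
  - unfold q. field. lra.
Qed.

(** * The algebra D *)

Lemma term_le_Series (a : nat -> R) (n : nat) :
  (forall k, 0 <= a k) -> ex_series a -> a n <= Series a.
Proof.
  intros H Ha.
  assert (S0 : forall m, 0 <= Series (fun k => a (m + k)%nat)).
  { intros m. replace 0 with (Series (fun k => 0 * a k)).
    - apply Series_le; [|apply (ex_series_incr_n a m), Ha].
      intros k. rewrite Rmult_0_l. split; [lra|apply H].
    - rewrite Series_scal_l. ring. }
  rewrite (Series_incr_n a (S n)) by (lia || exact Ha). simpl pred.
  specialize (S0 (S n)).
  assert (a n <= sum_f_R0 a n).
  { destruct n as [|n]; simpl; [lra|]. pose proof (cond_pos_sum a n H). lra. }
  lra.
Qed.

Section Norm.

Variable M : nat -> R.
Hypothesis M_pos : forall n, 0 < M n.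

Lemma in_D_intro (f : R -> C) (F : nat -> R -> C) (B : nat -> R) :
  tower f F -> (forall n x, I01 x -> Cmod (F n x) <= B n) ->
  ex_series (fun n => B n / M n) ->
  in_D M f /\ norm_D M f <= Series (fun n => B n / M n).
Proof.
  intros HF HB Hs.
  assert (T : forall n, 0 <= D_terms M f n <= B n / M n).
  { intros n. unfold D_terms.
    destruct (supnorm01_le (Derive01_n f n) (B n)) as [H1 H2].
    { intros x Ix. rewrite (tower_Derive01_n f F n x HF Ix). apply HB, Ix. }
    assert (0 < / M n) by apply Rinv_0_lt_compat, M_pos.
    split; unfold Rdiv; [apply Rmult_le_pos|apply Rmult_le_compat_r]; lra. }
  split; [split|].
  - apply (tower_smooth01 f F), HF.
  - apply (@ex_series_le R_AbsRing R_CompleteNormedModule (D_terms M f)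
      (fun n => B n / M n)); [|exact Hs].
    intros n. change (Rabs (D_terms M f n) <= B n / M n).
    rewrite Rabs_pos_eq; apply T.
  - apply Series_le; assumption.
Qed.

Lemma in_D_bound (f : R -> C) (n : nat) (x : R) :
  in_D M f -> I01 x -> Cmod (Derive01_n f n x) <= supnorm01 (Derive01_n f n).
Proof.
  intros [Hf _] Ix.
  destruct (derivable01_bounded (Derive01_n f n) (Hf n)) as [B HB].
  apply (le_supnorm01 _ B); assumption.
Qed.

Lemma D_terms_nonneg (f : R -> C) (n : nat) : in_D M f -> 0 <= D_terms M f n.
Proof.
  intros Hf. unfold D_terms. apply Rmult_le_pos.
  - apply (supnorm01_le _ (supnorm01 (Derive01_n f n))).
    intros x Ix. apply in_D_bound; assumption.
  - apply Rlt_le, Rinv_0_lt_compat, M_pos.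
Qed.

Lemma norm_D_nonneg (f : R -> C) : in_D M f -> 0 <= norm_D M f.
Proof.
  intros Hf. apply Rle_trans with (D_terms M f 0).
  - apply D_terms_nonneg, Hf.
  - apply term_le_Series; [|apply Hf]. intros k. apply D_terms_nonneg, Hf.
Qed.

Lemma Derive01_n_le_norm_D (f : R -> C) (n : nat) (x : R) :
  in_D M f -> I01 x -> Cmod (Derive01_n f n x) / M n <= norm_D M f.
Proof.
  intros Hf Ix. apply Rle_trans with (D_terms M f n).
  - apply Rmult_le_compat_r; [apply Rlt_le, Rinv_0_lt_compat, M_pos|].
    apply in_D_bound; assumption.
  - apply term_le_Series; [|apply Hf]. intros k. apply D_terms_nonneg, Hf.
Qed.

(** Scalar multiples ([d = 0]) and differences ([d = -1]) are both instances, and [h] is constrained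
    on [0,1] only. *)
Lemma in_D_lin (f g h : R -> C) (c d : C) :
  in_D M f -> in_D M g -> (forall x, I01 x -> h x = (c * f x + d * g x)%C) ->
  in_D M h /\ norm_D M h <= Cmod c * norm_D M f + Cmod d * norm_D M g /\
  forall n x, I01 x ->
    Derive01_n h n x = (c * Derive01_n f n x + d * Derive01_n g n x)%C.
Proof.
  intros Hf Hg Hh.
  assert (Tf := smooth01_tower f (proj1 Hf)).
  assert (Tg := smooth01_tower g (proj1 Hg)).
  set (H := fun n x => (c * Derive01_n f n x + d * Derive01_n g n x)%C).
  assert (TH : tower h H).
  { split.
    - intros x Ix. symmetry. apply Hh, Ix.
    - intros n x Ix. unfold H.
      assert (S1 := is_derive01_mult _ _ x _ _ (is_derive01_const c x)
        (proj2 Tf n x Ix)).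
      assert (S2 := is_derive01_mult _ _ x _ _ (is_derive01_const d x)
        (proj2 Tg n x Ix)).
      assert (S3 := is_derive01_plus _ _ x _ _ S1 S2). cbv beta in S3.
      match type of S3 with is_derive01 _ _ ?l => match goal with
        |- is_derive01 _ _ ?m => replace m with l by ring end end.
      exact S3. }
  set (B := fun n => Cmod c * supnorm01 (Derive01_n f n)
    + Cmod d * supnorm01 (Derive01_n g n)).
  assert (E : forall n, Cmod c * D_terms M f n + Cmod d * D_terms M g n = B n / M n).
  { intros n. unfold B, D_terms, Rdiv. ring. }
  assert (S1 : ex_series (fun n => Cmod c * D_terms M f n)).
  { apply (ex_series_scal_l (Cmod c) _ (proj2 Hf)). }
  assert (S2 : ex_series (fun n => Cmod d * D_terms M g n)).
  { apply (ex_series_scal_l (Cmod d) _ (proj2 Hg)). }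
  destruct (in_D_intro h H B TH) as [R1 R2].
  - intros n x Ix. unfold H, B. eapply Rle_trans; [apply Cmod_triangle|].
    rewrite !Cmod_mult. apply Rplus_le_compat; apply Rmult_le_compat_l;
      try apply Cmod_ge_0; apply in_D_bound; assumption.
  - apply (ex_series_ext (fun n => Cmod c * D_terms M f n + Cmod d * D_terms M g n)).
    + exact E.
    + exact (ex_series_plus _ _ S1 S2).
  - split; [exact R1|]. split.
    + rewrite <- (Series_ext _ _ E), Series_plus, !Series_scal_l in R2 by assumption.
      exact R2.
    + intros n x Ix. apply (tower_Derive01_n h H n x TH Ix).
Qed.

End Norm.

(** Only finitely many derivatives are nonzero, and each is at most 1 in modulus since |x - x0| <=
    1. It shows that jets with n-th derivative 1 exist at every order; for [n = 1] and [x0 = 0] it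
    is the identity function. *)
Lemma taylor_monomial_in_D (M : nat -> R) (x0 : R) (n : nat) :
  (forall n, 0 < M n) -> I01 x0 ->
  exists f : R -> C, (forall x, f x = RtoC ((x - x0) ^ n / INR (fact n))) /\
    in_D M f /\ (forall k, (k < n)%nat -> Derive01_n f k x0 = 0%C) /\
    Derive01_n f n x0 = 1%C.
Proof.
  intros HM Ix0. set (p := fun m x => (x - x0) ^ m / INR (fact m)).
  set (F := fun k x => if (k <=? n)%nat then RtoC (p (n - k)%nat x) else 0%C).
  assert (D : forall m x, is_derive (p (S m)) x (p m x)).
  { intros m x. unfold p. rewrite fact_simpl, mult_INR.
    pose proof (INR_fact_neq_0 m). pose proof (not_0_INR (S m) ltac:(lia)).
    set (b := INR (fact m)) in *. clearbody b.
    auto_derive; [exact I|].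
    change (match m with O => 1 | S _ => INR m + 1 end) with (INR (S m)).
    unfold Rminus. field. split; assumption. }
  assert (T : tower (F O) F).
  { split; [reflexivity|]. intros k x Ix. unfold F.
    destruct (Nat.leb_spec k n); destruct (Nat.leb_spec (S k) n); try lia.
    - replace (n - k)%nat with (S (n - S k)) by lia. apply is_derive01_RtoC, D.
    - replace (n - k)%nat with O by lia.
      apply (is_derive01_ext (fun _ => RtoC (p O 0))); [exact Ix| |apply is_derive01_const].
      intros y _. unfold p. reflexivity.
    - apply is_derive01_const. }
  exists (F O). split; [|split; [|split]].
  - intros x. unfold F. simpl. rewrite Nat.sub_0_r. reflexivity.
  - apply (in_D_intro M HM (F O) F (fun k => if (k <=? n)%nat then 1 else 0) T).
    + intros k x Ix. unfold F. destruct (Nat.leb_spec k n); [|rewrite Cmod_0; lra].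
      rewrite Cmod_R. unfold p. generalize (n - k)%nat. intros m.
      unfold Rdiv. rewrite Rabs_mult, <- RPow_abs.
      assert (H1 : Rabs (x - x0) <= 1) by (unfold I01 in *; apply Rabs_le; lra).
      assert (H2 : 1 <= INR (fact m)).
      { apply (le_INR 1). pose proof (lt_O_fact m). lia. }
      rewrite (Rabs_pos_eq (/ INR (fact m)))
        by (apply Rlt_le, Rinv_0_lt_compat; lra).
      replace 1 with (1 * 1) by ring. apply Rmult_le_compat.
      * apply pow_le, Rabs_pos.
      * apply Rlt_le, Rinv_0_lt_compat; lra.
      * rewrite <- (pow1 m). apply pow_incr. split; [apply Rabs_pos|exact H1].
      * rewrite <- Rinv_1. apply Rinv_le_contravar; lra.
    + apply (ex_series_incr_n _ (S n)).
      apply (ex_series_ext (fun k => 0 * (/ 2) ^ k)).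
      * intros k. destruct (Nat.leb_spec (S n + k) n); [lia|].
        match goal with |- ?u = ?v => change (@eq R u v) end.
        unfold Rdiv. ring.
      * apply (ex_series_scal_l 0 (fun k => (/ 2) ^ k)).
        apply ex_series_geom. rewrite Rabs_pos_eq; lra.
  - intros k Hk. rewrite (tower_Derive01_n _ F k x0 T Ix0). unfold F.
    destruct (Nat.leb_spec k n); [|reflexivity].
    unfold p. rewrite Rminus_diag, pow_i by lia. unfold Rdiv.
    rewrite Rmult_0_l. reflexivity.
  - rewrite (tower_Derive01_n _ F n x0 T Ix0). unfold F.
    rewrite Nat.leb_refl, Nat.sub_diag. unfold p. simpl.
    rewrite Rdiv_1_r. reflexivity.
Qed.

(** The k-th derivative of a product, expanded by the product rule alone, so that differentiation
    matches the recursion. Generic operations let the same expansion serve complex values and their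
    real majorants. *)
Fixpoint leibniz {A : Type} (add mul : A -> A -> A) (k : nat) (F G : nat -> A) : A :=
  match k with
  | O => mul (F O) (G O)
  | S k' => add (leibniz add mul k' (fun n => F (S n)) G)
                (leibniz add mul k' F (fun n => G (S n)))
  end.

Definition prod_tower (F G : nat -> R -> C) (k : nat) (x : R) : C :=
  leibniz Cplus Cmult k (fun n => F n x) (fun n => G n x).

Lemma prod_tower_is_derive01 (F G : nat -> R -> C) (k : nat) (x : R) :
  (forall n, is_derive01 (F n) x (F (S n) x)) ->
  (forall n, is_derive01 (G n) x (G (S n) x)) ->
  is_derive01 (prod_tower F G k) x (prod_tower F G (S k) x).
Proof.
  revert F G. induction k as [|k IH]; intros F G HF HG.
  - apply is_derive01_mult; [apply HF|apply HG].
  - apply (is_derive01_plus (prod_tower (fun n => F (S n)) G k)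
      (prod_tower F (fun n => G (S n)) k)).
    + apply (IH (fun n => F (S n)) G); [intros n; apply HF|exact HG].
    + apply (IH F (fun n => G (S n))); [exact HF|intros n; apply HG].
Qed.

Lemma leibniz_zero (k : nat) (F G : nat -> C) :
  (forall j, (j <= k)%nat -> G j = 0%C) -> leibniz Cplus Cmult k F G = 0%C.
Proof.
  revert F G. induction k as [|k IH]; intros F G H; simpl.
  - rewrite H by lia. ring.
  - rewrite !IH; [ring| |]; intros j Hj; apply H; lia.
Qed.

Lemma leibniz_zero_l (k : nat) (F G : nat -> C) :
  (forall j, F j = 0%C) -> leibniz Cplus Cmult k F G = 0%C.
Proof.
  revert F G. induction k as [|k IH]; intros F G H; simpl.
  - rewrite H. ring.
  - rewrite !IH; [ring|exact H|]. intros j. apply H.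
Qed.

(** Every other term of the expansion puts fewer than [n] derivatives on the second factor. *)
Lemma leibniz_leading (n : nat) (F G : nat -> C) :
  (forall j, (j < n)%nat -> G j = 0%C) ->
  leibniz Cplus Cmult n F G = (F O * G n)%C.
Proof.
  revert G. induction n as [|n IH]; intros G H; simpl; [reflexivity|].
  rewrite IH by (intros j Hj; apply H; lia).
  rewrite leibniz_zero by (intros j Hj; apply H; lia). ring.
Qed.

Lemma Cmod_leibniz (k : nat) (F G : nat -> C) (a b : nat -> R) :
  (forall n, Cmod (F n) <= a n) -> (forall n, Cmod (G n) <= b n) ->
  Cmod (leibniz Cplus Cmult k F G) <= leibniz Rplus Rmult k a b.
Proof.
  revert F G a b. induction k as [|k IH]; intros F G a b HF HG; simpl.
  - rewrite Cmod_mult. apply Rmult_le_compat; try apply Cmod_ge_0; auto.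
  - eapply Rle_trans; [apply Cmod_triangle|].
    apply Rplus_le_compat; apply IH; auto.
Qed.

Lemma leibniz_binomial (k : nat) (a b : nat -> R) :
  leibniz Rplus Rmult k a b
  = sum_f_R0 (fun j => Binomial.C k j * (a j * b (k - j)%nat)) k.
Proof.
  assert (C0 : forall n, Binomial.C n 0 = 1).
  { intros n. unfold Binomial.C. rewrite Nat.sub_0_r. simpl.
    pose proof (INR_fact_neq_0 n). field. assumption. }
  assert (Cn : forall n, Binomial.C n n = 1).
  { intros n. unfold Binomial.C. rewrite Nat.sub_diag. simpl.
    pose proof (INR_fact_neq_0 n). field. assumption. }
  revert a b. induction k as [|k IH]; intros a b.
  - simpl. rewrite C0. ring.
  - simpl leibniz. rewrite !IH.
    rewrite (decomp_sum _ (S k)) by lia. simpl pred.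
    destruct k as [|k].
    + simpl. rewrite !C0, !Cn. ring.
    + rewrite (decomp_sum (fun j => _ * (a j * b (S _))) (S k)) by lia. simpl pred.
      rewrite (tech5 (fun j => _ * (a (S j) * b _)) k).
      rewrite (tech5 (fun i => Binomial.C (S (S k)) (S i) * _) k).
      rewrite !C0, !Cn, !Nat.sub_diag, !Nat.sub_0_r.
      (* Once both end terms are split off, the two shifted sums overlap termwise and Pascal's rule
         merges them. *)
      rewrite (sum_eq (fun i => Binomial.C (S (S k)) (S i) * (a (S i) * b (S (S k) - S i)%nat))
        (fun i => Binomial.C (S k) i * (a (S i) * b (S k - i)%nat)
          + Binomial.C (S k) (S i) * (a (S i) * b (S (S k - S i))))).
      2:{ intros i Hi. rewrite <- pascal by lia.
          replace (S (S k) - S i)%nat with (S k - i)%nat by lia.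
          replace (S (S k - S i)) with (S k - i)%nat by lia. ring. }
      rewrite plus_sum. ring.
Qed.

(** The weight inequality says that the binomial coefficient is at most M_k / (M_j M_(k-j)), so the
    Leibniz sum divided by M_k is dominated by a term of a Cauchy product. This is the
    submultiplicativity of the norm. *)
Lemma leibniz_weight (M : nat -> R) (k : nat) (a b : nat -> R) :
  weight_sequence M -> (forall n, 0 <= a n) -> (forall n, 0 <= b n) ->
  0 <= leibniz Rplus Rmult k a b / M k
    <= sum_f_R0 (fun j => (a j / M j) * (b (k - j)%nat / M (k - j)%nat)) k.
Proof.
  intros (HM & _ & HW) Ha Hb. rewrite leibniz_binomial.
  replace (sum_f_R0 _ k / M k) with
    (sum_f_R0 (fun j => Binomial.C k j * (a j * b (k - j)%nat) * / M k) k)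
    by (rewrite <- scal_sum; apply Rmult_comm).
  assert (Cpos : forall j, (j <= k)%nat -> 0 <= Binomial.C k j).
  { intros j Hj. unfold Binomial.C. apply Rlt_le, Rdiv_lt_0_compat.
    - apply INR_fact_lt_0.
    - apply Rmult_lt_0_compat; apply INR_fact_lt_0. }
  assert (P : forall n, 0 < / M n) by (intros; apply Rinv_0_lt_compat, HM).
  split.
  - rewrite <- (Rmult_0_l (INR (S k))), <- sum_cte. apply sum_Rle.
    intros j Hj. apply Rmult_le_pos; [|apply Rlt_le, P].
    apply Rmult_le_pos; [apply Cpos, Hj|apply Rmult_le_pos; auto].
  - apply sum_Rle. intros j Hj.
    assert (W := HW j (k - j)%nat). replace (k - j + j)%nat with k in W by lia.
    apply Rge_le in W.
    pose proof (HM j). pose proof (HM k). pose proof (HM (k - j)%nat).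
    apply Rle_trans with (M k / (M (k - j)%nat * M j) * (a j * b (k - j)%nat) * / M k).
    + apply Rmult_le_compat_r; [apply Rlt_le, P|].
      apply Rmult_le_compat_r; [apply Rmult_le_pos; auto|exact W].
    + right. field. lra.
Qed.

(* Multiplication by a bump at [x0] followed by a translation moves jets
   vanishing to order [n] from [x0] to [y0]. *)
Lemma transplant (M : nat -> R) (x0 y0 : R) :
  weight_sequence M -> non_quasi_analytic M -> 0 < x0 < 1 -> 0 < y0 < 1 ->
  exists K : R, forall h, in_D M h ->
    exists u, in_D M u /\ norm_D M u <= K * norm_D M h /\
      forall n, (forall k, (k < n)%nat -> Derive01_n h k x0 = 0%C) ->
        (forall k, (k < n)%nat -> Derive01_n u k y0 = 0%C) /\
        Derive01_n u n y0 = Derive01_n h n x0.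
Proof.
  intros hM hq Hx0 Hy0. assert (M_pos := proj1 hM).
  set (r := Rmin (Rmin x0 (1 - x0)) (Rmin y0 (1 - y0)) / 2).
  assert (Hr : 0 < r /\ 2 * r <= x0 /\ 2 * r <= 1 - x0 /\ 2 * r <= y0 /\ 2 * r <= 1 - y0).
  { pose proof (Rmin_l (Rmin x0 (1 - x0)) (Rmin y0 (1 - y0))).
    pose proof (Rmin_r (Rmin x0 (1 - x0)) (Rmin y0 (1 - y0))).
    pose proof (Rmin_l x0 (1 - x0)). pose proof (Rmin_r x0 (1 - x0)).
    pose proof (Rmin_l y0 (1 - y0)). pose proof (Rmin_r y0 (1 - y0)).
    assert (0 < Rmin (Rmin x0 (1 - x0)) (Rmin y0 (1 - y0)))
      by (repeat apply Rmin_pos; lra).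
    unfold r. lra. }
  destruct (denjoy_carleman_bump M x0 r M_pos hq (proj1 Hr))
    as (X & B & XD & XB & HB & XS & X1).
  (* An upper bound for the norm of the bump, independent of [h]. *)
  exists (Series (fun n => B n / M n)). intros h Hh.
  assert (Th := smooth01_tower h (proj1 Hh)).
  set (XC := fun n x => RtoC (X n x)).
  set (P := prod_tower XC (Derive01_n h)).
  set (c := x0 - y0).
  (* Farther away [y + c] may leave [0,1], where the derivatives of [h] are uncontrolled. The bump
     has radius [r], so both branches vanish between [r] and [2 * r] and the seam is invisible. *)
  set (E := fun k y => if Rlt_dec (Rabs (y - y0)) (2 * r) then P k (y + c) else 0%C).
  assert (inI : forall y, Rabs (y - y0) < 2 * r -> I01 (y + c)).
  { intros y Hy. apply Rabs_def2 in Hy. unfold c, I01. lra. }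
  assert (PD : forall k x, I01 x -> is_derive01 (P k) x (P (S k) x)).
  { intros k x Ix. apply prod_tower_is_derive01; intros n.
    - apply is_derive01_RtoC, XD.
    - apply (proj2 Th), Ix. }
  assert (PS : forall k x, r < Rabs (x - x0) -> P k x = 0%C).
  { intros k x Hx. apply leibniz_zero_l. intros j. unfold XC. rewrite XS by exact Hx.
    reflexivity. }
  assert (ES : forall k y, r < Rabs (y - y0) -> E k y = 0%C).
  { intros k y Hy. unfold E. destruct (Rlt_dec (Rabs (y - y0)) (2 * r)); [|reflexivity].
    apply PS. unfold c. replace (y + (x0 - y0) - x0) with (y - y0) by ring. exact Hy. }
  assert (TE : tower (E O) E).
  { split; [reflexivity|]. intros k y Iy.
    destruct (Rlt_dec (Rabs (y - y0)) (2 * r)) as [Hy|Hy].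
    - assert (near : forall z, Rabs (z - y) < 2 * r - Rabs (y - y0) ->
        Rabs (z - y0) < 2 * r).
      { intros z Hz. pose proof (Rabs_triang (z - y) (y - y0)) as T.
        replace (z - y + (y - y0)) with (z - y0) in T by ring. lra. }
      apply (is_derive01_local (fun z => P k (z + c)) _ _ _ (2 * r - Rabs (y - y0)));
        [exact Iy|lra| |].
      + intros z _ Hz. unfold E. destruct (Rlt_dec (Rabs (z - y0)) (2 * r)) as [|N];
          [reflexivity|]. destruct N. apply near, Hz.
      + unfold E. destruct (Rlt_dec (Rabs (y - y0)) (2 * r)); [|contradiction].
        apply (is_derive01_shift _ _ _ _ (2 * r - Rabs (y - y0))); [lra| |].
        * intros z Hz. apply inI, near, Hz.
        * apply PD, inI, Hy.
    - apply (is_derive01_local (fun _ => 0%C) _ _ _ r); [exact Iy|lra| |].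
      + intros z _ Hz. symmetry. apply ES.
        pose proof (Rabs_triang (y - z) (z - y0)) as T.
        replace (y - z + (z - y0)) with (y - y0) in T by ring.
        rewrite Rabs_minus_sym in Hz. lra.
      + rewrite ES by lra. apply is_derive01_const. }
  set (N := fun n => supnorm01 (Derive01_n h n)).
  assert (XB0 : forall n, 0 <= B n).
  { intros n. eapply Rle_trans; [apply Rabs_pos|apply (XB n 0)]. }
  assert (N0 : forall n, 0 <= N n).
  { intros n. eapply Rle_trans; [apply Cmod_ge_0|].
    apply (in_D_bound M h n x0 Hh). unfold I01; lra. }
  assert (B0 : forall n, 0 <= B n / M n).
  { intros n. apply Rmult_le_pos; [apply XB0|apply Rlt_le, Rinv_0_lt_compat, M_pos]. }
  assert (L := fun k => leibniz_weight M k B N hM XB0 N0).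
  (* The Cauchy product of two absolutely convergent series sums to the product of their sums, here
     [K * norm_D M h]. *)
  assert (SM : is_series (fun k => sum_f_R0 (fun j =>
      B j / M j * (N (k - j)%nat / M (k - j)%nat)) k)
      (Series (fun n => B n / M n) * norm_D M h)).
  { apply (is_series_mult (fun j => B j / M j) (fun j => N j / M j)).
    - apply Series_correct, HB.
    - apply (Series_correct (D_terms M h)), Hh.
    - apply (ex_series_ext (fun n => B n / M n)); [|exact HB].
      intros n. rewrite Rabs_pos_eq; [reflexivity|apply B0].
    - apply (ex_series_ext (D_terms M h)); [|apply Hh].
      intros n. symmetry. apply Rabs_pos_eq.
      apply (D_terms_nonneg M M_pos h n Hh). }
  assert (EX : ex_series (fun k => leibniz Rplus Rmult k B N / M k)).
  { eapply (@ex_series_le R_AbsRing R_CompleteNormedModule); [|eexists; exact SM].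
    intros k. change (norm ?u) with (Rabs u). rewrite Rabs_pos_eq; apply L. }
  destruct (in_D_intro M M_pos (E O) E (fun k => leibniz Rplus Rmult k B N) TE)
    as [R1 R2]; [|exact EX|].
  { intros k y Iy. unfold E. destruct (Rlt_dec (Rabs (y - y0)) (2 * r)) as [Hy|_].
    - apply Cmod_leibniz; intros n.
      + unfold XC. rewrite Cmod_R. apply XB.
      + apply (in_D_bound M h n _ Hh), inI, Hy.
    - rewrite Cmod_0. destruct (L k) as [L1 _]. pose proof (M_pos k).
      apply (Rmult_le_compat_r (M k)) in L1; [|lra].
      unfold Rdiv in L1. rewrite Rmult_assoc, Rinv_l in L1 by lra. lra. }
  exists (E O). split; [exact R1|]. split.
  - apply Rle_trans with (1 := R2). rewrite <- (is_series_unique _ _ SM).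
    apply Series_le; [exact L|eexists; exact SM].
  - intros n Hn.
    assert (V : forall k, Derive01_n (E O) k y0 = P k x0).
    { intros k. rewrite (tower_Derive01_n _ E k y0 TE) by (unfold I01; lra).
      unfold E. rewrite Rminus_diag, Rabs_R0. destruct (Rlt_dec 0 (2 * r)); [|lra].
      f_equal. unfold c. ring. }
    split.
    + intros k Hk. rewrite V. apply leibniz_zero. intros j Hj. apply Hn. lia.
    + rewrite V. unfold P, prod_tower.
      rewrite (leibniz_leading n _ (fun m => Derive01_n h m x0)) by exact Hn.
      unfold XC. rewrite X1. ring.
Qed.

(** * Jets and compactness *)

(* [f] vanishes to order [n] at [x] and [a] is its [n]-th derivative there. Only
   [n] derivatives are required, so that the chain rule can be iterated without
   first proving that composites are smooth. *)
Fixpoint jet (n : nat) (f : R -> C) (x : R) (a : C) : Prop :=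
  match n with
  | O => f x = a
  | S n' => f x = 0%C /\ exists g,
      (forall y, I01 y -> is_derive01 f y (g y)) /\ jet n' g x a
  end.

Lemma tower_jet (n : nat) (f : R -> C) (F : nat -> R -> C) (x : R) :
  tower f F -> I01 x -> (forall k, (k < n)%nat -> F k x = 0%C) ->
  jet n f x (F n x).
Proof.
  revert f F. induction n as [|n IH]; intros f F T Ix H; simpl.
  - symmetry. apply (proj1 T), Ix.
  - split; [rewrite <- (proj1 T) by exact Ix; apply H; lia|].
    exists (F 1%nat). split.
    + intros y Iy. apply (is_derive01_ext (F O)); [exact Iy|apply T|apply T, Iy].
    + apply (IH (F 1%nat) (fun k => F (S k))); [apply (tower_S f), T|exact Ix|].
      intros k Hk. apply H. lia.
Qed.

Lemma jet_tower (n : nat) (f : R -> C) (F : nat -> R -> C) (x : R) (a : C) :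
  tower f F -> I01 x -> jet n f x a ->
  (forall k, (k < n)%nat -> F k x = 0%C) /\ F n x = a.
Proof.
  revert f F. induction n as [|n IH]; intros f F T Ix H.
  - split; [lia|]. rewrite (proj1 T) by exact Ix. exact H.
  - destruct H as [H0 [g [Hg Hj]]].
    destruct (IH g (fun k => F (S k))) as [IH1 IH2]; [|exact Ix|exact Hj|].
    + split; [|intros m y Iy; apply (proj2 T), Iy].
      intros y Iy. rewrite <- (is_derive01_unique f y (g y) Iy (Hg y Iy)).
      symmetry. apply is_derive01_unique; [exact Iy|].
      apply (is_derive01_ext (F O)); [exact Iy|apply T|apply T, Iy].
    + split; [|exact IH2]. intros [|k] Hk.
      * rewrite (proj1 T) by exact Ix. exact H0.
      * apply IH1. lia.
Qed.

Lemma jet_weaken (n : nat) (f : R -> C) (x : R) (a : C) :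
  jet (S n) f x a -> jet n f x 0.
Proof.
  revert f. induction n as [|n IH]; intros f [H0 [g [Hg Hj]]]; [exact H0|].
  split; [exact H0|]. exists g. split; [exact Hg|]. apply IH, Hj.
Qed.

Lemma jet_plus (n : nat) (f g : R -> C) (x : R) (a b : C) :
  jet n f x a -> jet n g x b -> jet n (fun y => f y + g y)%C x (a + b)%C.
Proof.
  revert f g. induction n as [|n IH]; intros f g; simpl.
  - intros -> ->. reflexivity.
  - intros [F0 [f' [Hf Jf]]] [G0 [g' [Hg Jg]]]. split; [rewrite F0, G0; ring|].
    exists (fun y => f' y + g' y)%C. split; [|apply IH; assumption].
    intros y Iy. apply is_derive01_plus; auto.
Qed.

(** In (f h)' = f' h + f h' the second summand still vanishes one order higher than the first, so it
    adds 0 to the leading coefficient. *)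
Lemma jet_mult (n : nat) (f h : R -> C) (H : nat -> R -> C) (x : R) (a : C) :
  tower h H -> jet n f x a -> jet n (fun y => f y * h y)%C x (a * h x)%C.
Proof.
  revert f h H a. induction n as [|n IH]; intros f h H a T J.
  - simpl in *. rewrite J. reflexivity.
  - assert (J0 := jet_weaken _ _ _ _ J). destruct J as [F0 [f' [Hf Jf]]].
    split; [rewrite F0; ring|].
    exists (fun y => f' y * h y + f y * H 1%nat y)%C. split.
    + intros y Iy. apply is_derive01_mult; [apply Hf, Iy|].
      apply (is_derive01_ext (H O)); [exact Iy|apply T|apply T, Iy].
    + replace (a * h x)%C with (a * h x + 0 * H 1%nat x)%C by ring.
      apply jet_plus; [apply (IH f' h H); assumption|].
      apply (IH f (H 1%nat) (fun k => H (S k))); [apply (tower_S h), T|exact J0].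
Qed.

(** Since (f o phi)' = (f' o phi) phi', each differentiation multiplies the leading coefficient by
    phi'(x); all terms with higher derivatives of phi carry a vanishing factor. *)
Lemma jet_comp (n : nat) (f : R -> C) (phi : R -> R) (Phi : nat -> R -> C)
  (x : R) (a : C) :
  (forall y, I01 y -> I01 (phi y)) -> tower (as_C phi) Phi ->
  jet n f (phi x) a -> jet n (comp_op phi f) x (a * Phi 1%nat x ^ n)%C.
Proof.
  intros Hphi T. revert f. induction n as [|n IH]; intros f J.
  - simpl in *. unfold comp_op. rewrite J. ring.
  - destruct J as [F0 [g [Hg Jg]]]. split; [exact F0|].
    exists (fun y => comp_op phi g y * Phi 1%nat y)%C. split.
    + intros y Iy. apply (is_derive01_comp f phi); [exact Hphi|apply Hg, Hphi, Iy|].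
      apply (is_derive01_ext (Phi O)); [exact Iy|apply T|apply T, Iy].
    + replace (a * Phi 1%nat x ^ S n)%C with (a * Phi 1%nat x ^ n * Phi 1%nat x)%C
        by (simpl; ring).
      apply (jet_mult n _ _ (fun k => Phi (S k))); [apply (tower_S _ _ T)|].
      apply IH, Jg.
Qed.

(* Riesz's lemma for the flag of closed ideals of functions vanishing to order
   [n] at [x0], whose successive quotients are one-dimensional. *)
Lemma almost_extremal_jet (M : nat -> R) (x0 : R) (n : nat) :
  (forall n, 0 < M n) -> I01 x0 ->
  exists h, in_D M h /\ norm_D M h <= 2 /\
    (forall k, (k < n)%nat -> Derive01_n h k x0 = 0%C) /\
    Derive01_n h n x0 <> 0%C /\
    forall f, in_D M f -> (forall k, (k < n)%nat -> Derive01_n f k x0 = 0%C) ->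
      Cmod (Derive01_n f n x0) <= norm_D M f * Cmod (Derive01_n h n x0).
Proof.
  intros HM Ix0.
  set (V := fun f => in_D M f /\ (forall k, (k < n)%nat -> Derive01_n f k x0 = 0%C)
    /\ Derive01_n f n x0 = 1%C).
  assert (scale : forall f c, in_D M f ->
    (forall k, (k < n)%nat -> Derive01_n f k x0 = 0%C) ->
    let g := (fun x => c * f x)%C in
    in_D M g /\ norm_D M g <= Cmod c * norm_D M f /\
    (forall k, (k < n)%nat -> Derive01_n g k x0 = 0%C) /\
    Derive01_n g n x0 = (c * Derive01_n f n x0)%C).
  { intros f c Hf Z g.
    destruct (in_D_lin M HM f f g c 0 Hf Hf) as (G1 & G2 & G3).
    { intros x _. unfold g. ring. }
    rewrite Cmod_0, Rmult_0_l, Rplus_0_r in G2.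
    split; [exact G1|]. split; [exact G2|]. split.
    - intros k Hk. rewrite G3, Z by assumption. ring.
    - rewrite G3 by exact Ix0. ring. }
  (* The infimum of the norm on [V], taken as a negated supremum. Its value [d] is the reciprocal of
     the norm of the functional f -> f^(n)(x0) on functions vanishing to order [n]; it is positive
     because that functional is bounded by [M n]. *)
  destruct (completeness (fun s => exists f, V f /\ s = - norm_D M f)) as [s [Hu Hl]].
  - exists 0. intros s [f [[Hf _] ->]]. pose proof (norm_D_nonneg M HM f Hf). lra.
  - destruct (taylor_monomial_in_D M x0 n HM Ix0) as (f & _ & Hf).
    exists (- norm_D M f). exists f. split; [exact Hf|reflexivity].
  - set (d := - s).
    assert (Hd : forall f, V f -> d <= norm_D M f).
    { intros f Hf. assert (- norm_D M f <= s); [|unfold d; lra].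
      apply Hu. exists f. split; [exact Hf|reflexivity]. }
    assert (d_pos : 0 < d).
    { apply Rlt_le_trans with (/ M n); [apply Rinv_0_lt_compat, HM|].
      assert (s <= - / M n); [|unfold d; lra].
      apply Hl. intros t [f [[Hf [_ Hn]] ->]].
      pose proof (Derive01_n_le_norm_D M HM f n x0 Hf Ix0) as E.
      rewrite Hn, Cmod_1 in E. unfold Rdiv in E. lra. }
    (* The infimum need not be attained; a factor 2 is affordable. Dividing [f] by [d] gives norm at
       most 2 and n-th derivative [/ d]. *)
    assert (exists f, V f /\ norm_D M f <= 2 * d) as [f [[Hf [Z Hn]] Hfd]].
    { apply NNPP. intros Hne. assert (s <= - (2 * d)); [|unfold d in *; lra].
      apply Hl. intros t [f [Vf ->]]. apply Ropp_le_contravar.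
      apply Rnot_lt_le. intros Hlt. apply Hne. exists f. split; [exact Vf|lra]. }
    destruct (scale f (RtoC (/ d)) Hf Z) as (G1 & G2 & G3 & G4).
    assert (i_pos : 0 < / d) by (apply Rinv_0_lt_compat, d_pos).
    rewrite Hn, Cmult_1_r in G4.
    rewrite Cmod_R, Rabs_pos_eq in G2 by lra.
    eexists. split; [exact G1|]. split; [|split; [exact G3|split]].
    + eapply Rle_trans; [exact G2|].
      apply Rle_trans with (/ d * (2 * d)); [apply Rmult_le_compat_l; lra|].
      right. field. lra.
    + rewrite G4. intros H0. apply RtoC_inj in H0. lra.
    + intros g Hg Zg. rewrite G4, Cmod_R, Rabs_pos_eq by lra.
      set (a := Derive01_n g n x0).
      destruct (Ceq_dec a 0) as [Ea|Ea].
      { rewrite Ea, Cmod_0. apply Rmult_le_pos; [apply (norm_D_nonneg M HM g Hg)|lra]. }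
      assert (Ha : 0 < Cmod a) by (apply Cmod_gt_0, Ea).
      destruct (scale g (/ a)%C Hg Zg) as (K1 & K2 & K3 & K4).
      fold a in K4. rewrite Cinv_l in K4 by exact Ea.
      specialize (Hd _ (conj K1 (conj K3 K4))).
      rewrite Cmod_inv in K2 by exact Ea.
      apply Rmult_le_reg_r with (d * / Cmod a).
      { apply Rmult_lt_0_compat; [lra|apply Rinv_0_lt_compat, Ha]. }
      replace (Cmod a * (d * / Cmod a)) with d by (field; lra).
      replace (norm_D M g * / d * (d * / Cmod a)) with (/ Cmod a * norm_D M g)
        by (field; lra).
      lra.
Qed.

(** At a boundary value of [phi] the increments [p] and [q] over steps [h] and [-h] have the same
    sign, so |p| <= |p + q|. The linear parts cancel in [p + q], whereas |p| is nearly |l| h.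
    Working with moduli allows a complex [l]; the tolerance 1/4 gives |p + q| <= h / 2 against |p|
    >= 3 h / 4. *)
Lemma interior_extremum (phi : R -> R) (x : R) (l : C) :
  0 < x < 1 -> (forall y, I01 y -> I01 (phi y)) ->
  is_derive01 (as_C phi) x l -> 1 <= Cmod l -> 0 < phi x < 1.
Proof.
  intros Hx Hphi Hd Hl.
  assert (Hpx := Hphi x ltac:(unfold I01; lra)).
  destruct (proj1 (is_derive01_iff _ _ _) Hd (1/4)) as [d [Hd0 Hd1]]; [lra|].
  set (h := Rmin (d / 2) (Rmin x (1 - x))).
  pose proof (Rmin_l (d / 2) (Rmin x (1 - x))).
  pose proof (Rmin_r (d / 2) (Rmin x (1 - x))).
  pose proof (Rmin_l x (1 - x)). pose proof (Rmin_r x (1 - x)).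
  assert (Hh : 0 < h) by (unfold h; repeat apply Rmin_pos; lra).
  fold h in H, H0.
  assert (I1 : I01 (x + h)) by (unfold I01; lra).
  assert (I2 : I01 (x - h)) by (unfold I01; lra).
  assert (A1 : Rabs (x + h - x) = h).
  { replace (x + h - x) with h by ring. apply Rabs_pos_eq. lra. }
  assert (A2 : Rabs (x - h - x) = h).
  { replace (x - h - x) with (- h) by ring. rewrite Rabs_Ropp. apply Rabs_pos_eq. lra. }
  assert (E1 := Hd1 (x + h) I1 ltac:(lra)).
  assert (E2 := Hd1 (x - h) I2 ltac:(lra)).
  rewrite A1 in E1. rewrite A2 in E2. unfold as_C in E1, E2.
  set (p := phi (x + h) - phi x). set (q := phi (x - h) - phi x).
  replace (phi (x + h)%R - phi x - l * (x + h - x)%R)%C with (p - l * h)%C in E1.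
  2:{ unfold p. rewrite RtoC_minus. replace (x + h - x)%R with h by ring. reflexivity. }
  replace (phi (x - h)%R - phi x - l * (x - h - x)%R)%C with (q + l * h)%C in E2.
  2:{ unfold q. rewrite RtoC_minus. replace (x - h - x)%R with (- h)%R by ring.
      rewrite RtoC_opp. ring. }
  assert (E3 : Rabs (p + q) <= h / 2).
  { rewrite <- Cmod_R, RtoC_plus.
    replace (p + q)%C with ((p - l * h) + (q + l * h))%C by ring.
    eapply Rle_trans; [apply Cmod_triangle|]. lra. }
  assert (E4 : Cmod l * h <= Rabs p + 1 / 4 * h).
  { rewrite <- (Rabs_pos_eq h) at 1 by lra. rewrite <- !Cmod_R, <- Cmod_mult.
    replace (l * h)%C with (p + - (p - l * h))%C by ring.
    eapply Rle_trans; [apply Cmod_triangle|]. rewrite Cmod_opp. lra. }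
  assert (Hp : h / 2 < Rabs p) by nra.
  assert (Ip := Hphi _ I1). assert (Iq := Hphi _ I2). unfold I01 in *.
  apply Rabs_le_between in E3.
  split; apply Rnot_le_lt; intros Hc.
  - rewrite Rabs_pos_eq in Hp by (unfold p; lra). unfold p, q in *. lra.
  - rewrite Rabs_left1 in Hp by (unfold p; lra). unfold p, q in *. lra.
Qed.

Theorem theorem1p5 (M : nat -> R) (phi : R -> R)
  (hM : weight_sequence M) (hnqa : non_quasi_analytic M)
  (hphi : forall x : R, I01 x -> I01 (phi x))
  (hcomp : induces_compact_endomorphism M phi) :
  (* phi lies in D([0,1],M), so phi' below is a genuine derivative *)
  in_D M (as_C phi) /\
  (forall x : R, 0 < x < 1 -> Cmod (Derive01 (as_C phi) x) < 1) /\
  ((exists x0 : R, 0 < x0 < 1 /\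
      forall y : R, I01 y ->
        Cmod (Derive01 (as_C phi) y) <= Cmod (Derive01 (as_C phi) x0)) ->
   supnorm01 (Derive01 (as_C phi)) < 1).
Proof.
  assert (M_pos := proj1 hM). destruct hcomp as [hend hcpt].
  assert (phiD : in_D M (as_C phi)).
  { destruct (taylor_monomial_in_D M 0 1 M_pos) as (f & Ef & Hf & _);
      [unfold I01; lra|].
    destruct (in_D_lin M M_pos f f RtoC 1 0 Hf Hf) as [idD _].
    - intros x _. rewrite Ef. simpl. rewrite Rminus_0_r, Rmult_1_r, Rdiv_1_r. ring.
    (* The identity function of [0,1] is [RtoC], and its composite with [phi] is [as_C phi] by
       computation. *)
    - exact (hend RtoC idD). }
  assert (main : forall x, 0 < x < 1 -> Cmod (Derive01 (as_C phi) x) < 1).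
  { intros x0 Hx0. apply Rnot_le_lt. intros Hl.
    assert (Ix0 : I01 x0) by (unfold I01; lra).
    assert (Tphi := smooth01_tower _ (proj1 phiD)).
    set (l := Derive01 (as_C phi) x0) in *.
    assert (Hy0 : 0 < phi x0 < 1).
    { apply (interior_extremum phi x0 l); try assumption. apply (proj2 Tphi O x0 Ix0). }
    destruct (transplant M x0 (phi x0) hM hnqa Hx0 Hy0) as [K HK].
    (* Here [h] is the almost extremal function and [u] its transplant to [phi x0]. They are paired
       so that one choice selects both. *)
    assert (W : forall n, exists hu : (R -> C) * (R -> C),
      let (h, u) := hu in
      in_D M u /\ norm_D M u <= Rabs K * 2 /\
      Derive01_n h n x0 <> 0%C /\
      (forall f, in_D M f -> (forall k, (k < n)%nat -> Derive01_n f k x0 = 0%C) ->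
        Cmod (Derive01_n f n x0) <= norm_D M f * Cmod (Derive01_n h n x0)) /\
      (forall k, (k < n)%nat -> Derive01_n (comp_op phi u) k x0 = 0%C) /\
      Derive01_n (comp_op phi u) n x0 = (Derive01_n h n x0 * l ^ n)%C).
    { intros n.
      destruct (almost_extremal_jet M x0 n M_pos Ix0) as (h & Hh & Nh & Zh & Ah & Xh).
      destruct (HK h Hh) as (u & Hu & Nu & Ju). destruct (Ju n Zh) as [Ju1 Ju2].
      exists (h, u). split; [exact Hu|]. split.
      (* The sign of [K] is not recorded by [transplant], hence [Rabs K]. *)
      { pose proof (norm_D_nonneg M M_pos h Hh). pose proof (Rle_abs K).
        pose proof (Rabs_pos K). nra. }
      split; [exact Ah|]. split; [exact Xh|].
      rewrite <- Ju2.
      apply (jet_tower n (comp_op phi u)); [|exact Ix0|].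
      - apply smooth01_tower, hend, Hu.
      - apply (jet_comp n u phi _ x0 _ hphi Tphi).
        apply tower_jet; [apply smooth01_tower, Hu|apply hphi, Ix0|exact Ju1]. }
    set (hu := fun n => proj1_sig (constructive_indefinite_description _ (W n))).
    assert (Hhu := fun n => proj2_sig (constructive_indefinite_description _ (W n))).
    fold (hu) in Hhu.
    set (T := fun n => comp_op phi (snd (hu n))).
    assert (TD : forall n, in_D M (T n)).
    { intros n. apply hend. specialize (Hhu n). cbv beta in Hhu. fold (hu n) in Hhu.
      destruct (hu n). apply Hhu. }
    (* [T j] vanishes to order [j > i] at [x0], so the i-th derivative of the difference is that of
       [T i], namely [l ^ i] times that of [hi]. Extremality of [hi] bounds its modulus by the norm
       times that same derivative, which cancels and leaves |l|^i. *)
    assert (sep : forall i j, (i < j)%nat ->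
      1 <= norm_D M (fun x => T i x - T j x)%C).
    { intros i j Hij.
      destruct (in_D_lin M M_pos (T i) (T j) (fun x => T i x - T j x)%C 1 (-(1))
        (TD i) (TD j)) as (G1 & _ & G3).
      { intros x _. ring. }
      assert (Hi := Hhu i). assert (Hj := Hhu j). cbv beta in Hi, Hj.
      fold (hu i) in Hi. fold (hu j) in Hj. unfold T in *.
      destruct (hu i) as [hi ui]. destruct (hu j) as [hj uj]. simpl in *.
      destruct Hi as (_ & _ & Ai & Xi & Zi & Li). destruct Hj as (_ & _ & _ & _ & Zj & _).
      specialize (Xi _ G1). rewrite G3, Li, Zj in Xi by assumption.
      replace (1 * (Derive01_n hi i x0 * l ^ i) + - (1) * 0)%C with
        (Derive01_n hi i x0 * l ^ i)%C in Xi by ring.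
      rewrite Cmod_mult, Cmod_pow, Rmult_comm in Xi.
      assert (HA : 0 < Cmod (Derive01_n hi i x0)) by (apply Cmod_gt_0, Ai).
      apply Rle_trans with (Cmod l ^ i); [apply pow_R1_Rle, Hl|].
      apply Rmult_le_reg_r with (1 := HA). apply Xi.
      intros k Hk. rewrite G3, Zi, Zj by (assumption || lia). ring. }
    destruct (hcpt (fun n => snd (hu n))) as (k & g & Hk & Hg & Hlim).
    - intros n. specialize (Hhu n). cbv beta in Hhu. fold (hu n) in Hhu.
      destruct (hu n). apply Hhu.
    - exists (Rabs K * 2). intros n. specialize (Hhu n). cbv beta in Hhu.
      fold (hu n) in Hhu. destruct (hu n). apply Hhu.
    (* Two consecutive terms within 1/2 of the limit would be at distance less than 1, against the
       separation. *)
    - apply is_lim_seq_spec in Hlim. destruct (Hlim (mkposreal (1/2) ltac:(lra))) as [N HN].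
      assert (N1 := HN N (le_n N)). assert (N2 := HN (S N) (le_S _ _ (le_n N))).
      cbv beta in N1, N2. change (comp_op phi (snd (hu (k N)))) with (T (k N)) in N1.
      change (comp_op phi (snd (hu (k (S N))))) with (T (k (S N))) in N2.
      simpl in N1, N2. rewrite Rminus_0_r in N1, N2.
      assert (D1 : forall n, in_D M (fun x => T n x - g x)%C).
      { intros n. apply (in_D_lin M M_pos (T n) g _ 1 (-(1)) (TD n) Hg).
        intros x _. ring. }
      destruct (in_D_lin M M_pos _ _ (fun x => T (k N) x - T (k (S N)) x)%C 1 (-(1))
        (D1 (k N)) (D1 (k (S N)))) as (_ & G2 & _).
      { intros x _. ring. }
      rewrite Cmod_opp, Cmod_1 in G2.
      specialize (sep _ _ (Hk N)).
      apply Rabs_def2 in N1. apply Rabs_def2 in N2. lra. }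
  split; [exact phiD|]. split; [exact main|].
  intros (x0 & Hx0 & Hmax). apply Rle_lt_trans with (2 := main x0 Hx0).
  apply supnorm01_le. exact Hmax.
Qed.
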